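(* Let $0\le\rho<m\le d-1$ be integers. Let $\mathcal F=\{A_1,\dots,A_{\rho+2}\}$ be a family of $\rho+2$ compact convex sets in $\mathbb R^d$, and let $\alpha_i\in A_i$, $i=1,\dots,\rho+2$, be some points. Suppose that there is no $\rho$-transversal to $\mathcal F$, i.e. no $\rho$-dimensional affine plane intersects all of $A_1,\dots,A_{\rho+2}$. Then the inclusion $$\mathcal T_m(\{\alpha_1,\dots,\alpha_{\rho+2}\})\subset\mathcal T_m(\mathcal F)$$ is a homotopy equivalence. In particular, $\mathcal T_m(\mathcal F)$ has the homotopy type of the Grassmannian $G(d-\rho-1,m-\rho-1)$, and in the case $m=\rho+1$ the set $\mathcal T_m(\mathcal F)$ is contractible.
   Context: ''Plane'' means affine plane. For a family $\mathcal F$ of compact convex sets in $\mathbb R^d$, $\mathcal T_m(\mathcal F)$ is the space of all affine $m$-planes in $\mathbb R^d$ that intersect every member of $\mathcal F$, topologized as a subspace of the space $M(d,m)$ of all affine $m$-planes of $\mathbb R^d$ (with its usual topology, as an open subset of the Grassmannian $G(d+1,m+1)$). For points, $\mathcal T_m(\{\alpha_1,\dots,\alpha_{\rho+2}\})$ is the space of affine $m$-planes containing all the points $\alpha_i$. $G(N,n)$ is the Grassmannian of $n$-dimensional linear subspaces of $\mathbb R^N$ ($G(N,0)$ is a point). *)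

(* Defs.v *)
From HB Require Import structures.
From mathcomp Require Import all_boot all_order all_algebra.
From mathcomp Require Import all_classical all_reals all_analysis.

Set Implicit Arguments.
Unset Strict Implicit.
Unset Printing Implicit Defensive.

Import Order.TTheory GRing.Theory Num.Theory.
Import numFieldNormedType.Exports.

Local Open Scope classical_set_scope.
Local Open Scope ring_scope.

Section Homotopy.
Variable R : realType.

Definition homotopic (X Y : topologicalType) (f g : X -> Y) : Prop :=
  exists H : X * R -> Y,
    [/\ {within [set: X] `*` `[0, 1]%classic, continuous H},
        forall x, H (x, 0) = f x & forall x, H (x, 1) = g x].

Definition homotopy_equivalence (X Y : topologicalType) (f : X -> Y) : Prop :=
  continuous f /\
  exists2 g : Y -> X, continuous g &
    homotopic (g \o f) idfun /\ homotopic (f \o g) idfun.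

Definition same_homotopy_type (X Y : topologicalType) : Prop :=
  exists f : X -> Y, homotopy_equivalence f.

Definition contractible (X : topologicalType) : Prop :=
  exists x0 : X, homotopic (@idfun X) (fun=> x0).

End Homotopy.

Section Grassmannian.
Variables (R : realType) (N n : nat).

Record grassmannian := Grassmannian {
  subspace_of :> {vspace 'rV[R]_N};
  _ : \dim subspace_of == n
}.

HB.instance Definition _ := [isSub for subspace_of].
HB.instance Definition _ := [Choice of grassmannian by <:].

Definition rows (A : 'M[R]_(n, N)) : n.-tuple 'rV[R]_N :=
  [tuple row i A | i < n].

Definition frames : set 'M[R]_(n, N) := [set A | free (rows A)].

Lemma dim_frame (A : frames) : \dim <<rows (val A)>>%VS == n.
Proof. by have := set_mem (valP A); rewrite /frames /= /free size_tuple card_ord. Qed.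

Definition frame_span (A : frames) : grassmannian := Grassmannian (dim_frame A).

(* The quotient topology of the (noncompact) Stiefel space of n-frames in R^N,
   two frames being identified when they span the same subspace. *)
Definition grassmannian_open (U : set grassmannian) : Prop :=
  open (frame_span @^-1` U).

Let grassmannian_openT : grassmannian_open setT.
Proof. by rewrite /grassmannian_open preimage_setT; exact: openT. Qed.

Let grassmannian_openI : setI_closed grassmannian_open.
Proof.
by move=> U V oU oV; rewrite /grassmannian_open preimage_setI; exact: openI.
Qed.

Let grassmannian_open_bigU (I : Type) (U : I -> set grassmannian) :
  (forall i, grassmannian_open (U i)) -> grassmannian_open (\bigcup_i U i).
Proof.
move=> oU; rewrite /grassmannian_open preimage_bigcup.
by apply: bigcup_open => i _; exact: oU.
Qed.

HB.instance Definition _ := isOpenTopological.Build grassmannian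
  grassmannian_openT grassmannian_openI grassmannian_open_bigU.

End Grassmannian.

Section AffinePlanes.
Variables (R : realType) (d m : nat).

(* R^d is the chart x |-> (x, 1) of the hyperplane of height 1 in R^(d+1). *)
Definition chart_points (W : grassmannian R (d + 1) (m + 1)) : set 'rV[R]_d :=
  [set x | row_mx x (const_mx 1) \in (W : {vspace _})].

(* The affine m-planes of R^d, as the part of G(d+1, m+1) made of the subspaces
   not contained in the hyperplane at infinity (height 0), topologized as a
   subspace of G(d+1, m+1).  Lemmas plane_pointsP and plane_points_inj below
   show that P |-> plane_points P is a bijection from this space onto the set of
   translates of the m-dimensional linear subspaces of R^d. *)
Definition affine_plane_set : set (grassmannian R (d + 1) (m + 1)) :=
  [set W | chart_points W !=set0].

Definition affine_plane : topologicalType := affine_plane_set.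

Definition plane_points (P : affine_plane) : set 'rV[R]_d :=
  chart_points (val P).

End AffinePlanes.

Section AffinePlanesTheory.
Variables (R : realType) (d m : nat).

Let hom (p : 'rV[R]_d) : 'rV[R]_(d + 1) := row_mx p (const_mx 1).

Let iota : 'Hom('rV[R]_d, 'rV[R]_(d + 1)) := linfun (mulmxr (row_mx 1%:M 0)).

Let iotaE x : iota x = row_mx x 0.
Proof. by rewrite lfunE /= mul_mx_row mulmx1 mulmx0. Qed.

Let ker_iota : lker iota == 0%VS.
Proof.
by apply/lker0P => x y; rewrite !iotaE => /eq_row_mx[].
Qed.

Let homB p q : hom q = hom p + iota (q - p).
Proof. by rewrite iotaE /hom add_row_mx addr0 addrC subrK. Qed.

Let cone (p : 'rV[R]_d) (V : {vspace 'rV[R]_d}) := (iota @: V + <[hom p]>)%VS.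

Let const1_neq0 : const_mx 1 != 0 :> 'rV[R]_1.
Proof. by apply/eqP => /matrixP/(_ 0 0)/eqP; rewrite !mxE oner_eq0. Qed.

Let dim_cone p V : \dim (cone p V) = (\dim V + 1)%N.
Proof.
have hp0 : hom p != 0.
  by apply: contra const1_neq0 => /eqP/(congr1 rsubmx); rewrite row_mxKr linear0 => ->.
rewrite /cone dimv_disjoint_sum ?limg_dim_eq ?dim_vline ?hp0//.
  by rewrite (eqP ker_iota) capv0.
apply/eqP; rewrite -subv0; apply/subvP => w /memv_capP[/memv_imgP[v _ ->]].
move=> /vlineP[k]; rewrite iotaE /hom scale_row_mx => /eq_row_mx[-> +].
have [-> _|k0 /esym/eqP] := eqVneq k 0; first by rewrite scale0r row_mx0 memv0.
by rewrite scaler_eq0 (negPf k0) (negPf const1_neq0).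
Qed.

Let mem_cone p V x : (hom x \in cone p V) = (x - p \in V).
Proof.
apply/idP/idP => [/memv_addP[_ /memv_imgP[v Vv ->] [_ /vlineP[k ->]]]|xpV].
  rewrite iotaE /hom scale_row_mx add_row_mx add0r => /eq_row_mx[-> k1].
  have -> : k = 1.
    by have /matrixP/(_ 0 0) := k1; rewrite !mxE mulr1.
  by rewrite scale1r addrK.
by rewrite (homB p x) addrC memv_add ?memv_img ?memv_line.
Qed.

Let cone_eq p (W : {vspace 'rV[R]_(d + 1)}) : hom p \in W ->
  W = cone p (iota @^-1: W)%VS.
Proof.
move=> pW; apply/eqP; rewrite eqEsubv; apply/andP; split; last first.
  rewrite subv_add -memvE pW andbT.
  by apply/subvP => _ /memv_imgP[v vW ->]; rewrite -memv_preim in vW.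
apply/subvP => w wW; set k := w 0 (rshift d 0).
have wE : w = iota (lsubmx w - k *: p) + k *: hom p.
  rewrite iotaE /hom scale_row_mx add_row_mx subrK add0r -[LHS]hsubmxK.
  by congr row_mx; apply/matrixP => i j; rewrite !mxE !ord1 mulr1.
rewrite {1}wE memv_add ?memvZ ?memv_line// memv_img// -memv_preim.
have -> : iota (lsubmx w - k *: p) = w - k *: hom p by rewrite {2}wE addrK.
by rewrite rpredB// memvZ.
Qed.

Lemma plane_pointsP (L : set 'rV[R]_d) :
  (exists P : affine_plane R d m, plane_points P = L) <->
  exists (p : 'rV[R]_d) (V : {vspace 'rV[R]_d}),
    \dim V = m /\ L = [set x | x - p \in V].
Proof.
split=> [[[[W dW] /= /[dup] /set_mem [p /= pW] PW] <-]|[p [V [dV ->]]]].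
  exists p, (iota @^-1: W)%VS; split.
    apply/eqP; rewrite -(eqn_add2r 1) -(dim_cone p) -(cone_eq pW) //.
  apply/seteqP; split=> x;
    by rewrite /plane_points /chart_points /= -mem_cone -(cone_eq pW).
have dW : \dim (cone p V) == (m + 1)%N by rewrite dim_cone dV.
have PW : (Grassmannian dW) \in affine_plane_set (m := m).
  by apply/mem_set; exists p; rewrite /chart_points /= mem_cone subrr mem0v.
exists (SigSub PW : affine_plane_set (m := m)).
by apply/seteqP; split=> x;
  rewrite /plane_points /chart_points /= -/(hom x) mem_cone.
Qed.

Lemma plane_points_inj : injective (@plane_points R d m).
Proof.
move=> [[W dW] /= /[dup] /set_mem [p /= pW] PW] [[W' dW'] /= PW'].
rewrite /plane_points /= => eqW.
have {}pW : hom p \in W by [].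
have pW' : hom p \in W' by have : chart_points (Grassmannian dW') p by rewrite -eqW.
apply/val_inj/val_inj => /=; rewrite [LHS](cone_eq pW) [RHS](cone_eq pW'); congr cone.
apply/vspaceP => v; rewrite -!memv_preim.
have E (U : {vspace 'rV[R]_(d + 1)}) :
    hom p \in U -> (iota v \in U) = (hom (p + v) \in U).
  by move=> pU; rewrite (homB p) addrAC subrr add0r rpredDl.
rewrite (E _ pW) (E _ pW').
by apply/idP/idP => h;
  [have : chart_points (Grassmannian dW') (p + v) by rewrite -eqW
  |have : chart_points (Grassmannian dW) (p + v) by rewrite eqW].
Qed.

End AffinePlanesTheory.

Section Transversals.
Variables (R : realType) (d m k : nat).

Definition transversals (A : 'I_k -> set 'rV[R]_d) : set (affine_plane R d m) :=
  [set P | forall i, plane_points P `&` A i !=set0].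

Definition planes_through (a : 'I_k -> 'rV[R]_d) : set (affine_plane R d m) :=
  [set P | forall i, plane_points P (a i)].

Lemma planes_through_sub (A : 'I_k -> set 'rV[R]_d) (a : 'I_k -> 'rV[R]_d) :
  (forall i, A i (a i)) -> planes_through a `<=` transversals A.
Proof. by move=> aA P Pa i; exists (a i). Qed.

End Transversals.
Arguments transversals {R d} m {k} A.
Arguments planes_through {R d} m {k} a.

(* Main.v *)
(* Points of R^d are identified with their lifts (x, 1) to R^(d+1).  Since there
   is no rho-transversal, any choice a of points a_i in A_i is linearly
   independent.  Let W be the linear span of a plane P.  If a is close to P, then
   the span of a meets the orthogonal complement of W trivially, and P can be
   tilted canonically to a plane through a; P is unchanged if it already contains
   a.  The points of A_i nearest to P do not depend continuously on P, but for
   s > 0 the minimizer a_s(P) of dist(a, W)^2 + s |a - alpha|^2 over the product of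
   the A_i does, and its distance to P is O(sqrt s).  By compactness, tilting P to
   a_s(P) extends continuously by the identity at s = 0.  For some fixed small s,
   the tilted plane is then moved along the segment from a_s(P) to alpha by
   finitely many small tilts.  Planes through alpha stay fixed throughout; they
   correspond to the subspaces of the quotient of R^(d+1) by the span of alpha. *)
Require Import Defs.
From mathcomp Require Import all_boot all_order all_algebra.
From mathcomp Require Import all_classical all_reals all_analysis.
From mathcomp Require Import ring lra zify.
Import Order.TTheory GRing.Theory Num.Theory.
Import numFieldNormedType.Exports.
Local Open Scope classical_set_scope.
Local Open Scope ring_scope.

Set Implicit Arguments.
Unset Strict Implicit.
Unset Printing Implicit Defensive.

(** * Orthogonal projections onto row spaces *)

Section SumOfSquares.
Variable R : realType.

Definition sqnorm p q (X : 'M[R]_(p, q)) : R := \sum_i \sum_j X i j ^+ 2.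

Lemma sqnorm_ge0 p q (X : 'M[R]_(p, q)) : 0 <= sqnorm X.
Proof. by apply: sumr_ge0 => i _; apply: sumr_ge0 => j _; exact: sqr_ge0. Qed.

Lemma sqnorm_entry p q (X : 'M[R]_(p, q)) i j : X i j ^+ 2 <= sqnorm X.
Proof.
rewrite /sqnorm (bigD1 i)//= (bigD1 j)//= -addrA lerDl addr_ge0//.
  by apply: sumr_ge0 => ? _; exact: sqr_ge0.
by apply: sumr_ge0 => ? _; apply: sumr_ge0 => ? _; exact: sqr_ge0.
Qed.

Lemma sqnorm_eq0 p q (X : 'M[R]_(p, q)) : (sqnorm X == 0) = (X == 0).
Proof.
apply/eqP/eqP => [X0|->]; last first.
  by apply: big1 => i _; apply: big1 => j _; rewrite mxE expr0n.
apply/matrixP => i j; rewrite mxE; apply/eqP; rewrite -sqrf_eq0.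
by rewrite eq_le sqr_ge0 -X0 sqnorm_entry.
Qed.

Lemma sqnorm0 p q : sqnorm (0 : 'M[R]_(p, q)) = 0.
Proof. by apply/eqP; rewrite sqnorm_eq0. Qed.

Lemma sqnormE p q (X : 'M[R]_(p, q)) : sqnorm X = \tr (X *m X^T).
Proof.
apply: eq_bigr => i _; rewrite mxE; apply: eq_bigr => j _.
by rewrite mxE expr2.
Qed.

Lemma sqnormZ p q a (X : 'M[R]_(p, q)) : sqnorm (a *: X) = a ^+ 2 * sqnorm X.
Proof. by rewrite !sqnormE linearZ/= -scalemxAl -scalemxAr !linearZ/=; ring. Qed.

Lemma sqnorm_midpoint p q (X Y : 'M[R]_(p, q)) :
  sqnorm (2^-1 *: (X + Y)) =
  2^-1 * (sqnorm X + sqnorm Y) - 4^-1 * sqnorm (X - Y).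
Proof.
rewrite /sqnorm -big_split/= !mulr_sumr -sumrB; apply: eq_bigr => i _.
rewrite -big_split/= !mulr_sumr -sumrB; apply: eq_bigr => j _.
by rewrite !mxE; field.
Qed.

(** If [v *m X *m X^T = 0], then [v *m X] has zero sum of squares and vanishes, so row freeness
    gives [v = 0]. *)
Lemma row_free_gram p q (X : 'M[R]_(p, q)) :
  row_free X = (X *m X^T \in unitmx).
Proof.
rewrite -row_free_unit; apply/idP/idP => [fX|]; last first.
  by move=> /row_freeP[Y XY]; apply/row_freeP; exists (X^T *m Y); rewrite mulmxA.
apply/inj_row_free => v /(congr1 (mulmx^~ v^T)); rewrite mul0mx => vX.
have : sqnorm (v *m X) == 0.
  by rewrite sqnormE trmx_mul !mulmxA -[v *m X *m _]mulmxA vX linear0.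
by rewrite sqnorm_eq0 (mulmx_free_eq0 _ fX) => /eqP.
Qed.

(* The orthogonal projection onto the row space of [X] when [X] is row free;
   row vectors are acted on from the right. *)
Definition gram_proj p q (X : 'M[R]_(p, q)) : 'M[R]_q :=
  X^T *m invmx (X *m X^T) *m X.

Lemma gram_proj_tr p q (X : 'M[R]_(p, q)) : (gram_proj X)^T = gram_proj X.
Proof.
by rewrite /gram_proj !trmx_mul trmxK trmx_inv trmx_mul trmxK mulmxA.
Qed.

Lemma mul_gram_proj p q (X : 'M[R]_(p, q)) : row_free X ->
  X *m gram_proj X = X.
Proof.
by rewrite row_free_gram => u; rewrite /gram_proj !mulmxA mulmxV// mul1mx.
Qed.

Lemma gram_proj_eqmx p q (X : 'M[R]_(p, q)) : row_free X ->
  (gram_proj X :=: X)%MS.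
Proof.
move=> fX; apply/eqmxP; rewrite submxMl/=.
by rewrite -{1}(mul_gram_proj fX) submxMl.
Qed.

Lemma gram_projK p q (X : 'M[R]_(p, q)) : row_free X ->
  gram_proj X *m gram_proj X = gram_proj X.
Proof. by move=> fX; rewrite {1}/gram_proj -mulmxA mul_gram_proj. Qed.

(** Equal row spaces give [P *m Q = P] and [Q *m P = Q]; transposing the first identity turns its
    left side into that of the second. *)
Lemma orthoproj_uniq q (P Q : 'M[R]_q) : P^T = P -> Q^T = Q ->
  P *m P = P -> Q *m Q = Q -> (P :=: Q)%MS -> P = Q.
Proof.
move=> tP tQ PP QQ PQ.
have /submxP[U PU] : (P <= Q)%MS by rewrite PQ.
have /submxP[V QV] : (Q <= P)%MS by rewrite PQ.
have PQP : P *m Q = P by rewrite PU -mulmxA QQ.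
have QPQ : Q *m P = Q by rewrite QV -mulmxA PP.
by rewrite -tP -PQP trmx_mul tP tQ.
Qed.

End SumOfSquares.

Section RowSpan.
Variables (R : realType) (N : nat).

Lemma mem_span_rows p (X : 'M[R]_(p, N)) v :
  (v \in <<rows X>>%VS) = (v <= X)%MS.
Proof.
apply/idP/idP => [/coord_span ->|/submxP[u ->]].
  apply: summx_sub => i _; apply: scalemx_sub.
  by rewrite -tnth_nth tnth_mktuple row_sub.
rewrite mulmx_sum_row; apply: memv_suml => i _; apply: memvZ.
apply: memv_span; apply/tnthP; exists i.
by rewrite tnth_mktuple.
Qed.

Lemma free_rows p (X : 'M[R]_(p, N)) : free (rows X) = row_free X.
Proof.
apply/freeP/idP => [fX|fX k].
  apply/inj_row_free => v; rewrite mulmx_sum_row => vX; apply/rowP => i.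
  rewrite mxE; apply: (fX (v 0)); rewrite -[RHS]vX; apply: eq_bigr => j _.
  by rewrite -tnth_nth tnth_mktuple.
have -> : \sum_(i < p) k i *: (rows X)`_i = (\row_i k i) *m X.
  rewrite mulmx_sum_row; apply: eq_bigr => j _.
  by rewrite mxE -tnth_nth tnth_mktuple.
move/eqP; rewrite (mulmx_free_eq0 _ fX) => /eqP/rowP k0 i.
by have := k0 i; rewrite !mxE.
Qed.

Lemma eq_span_rows p q (X : 'M[R]_(p, N)) (Y : 'M[R]_(q, N)) :
  (X :=: Y)%MS -> <<rows X>>%VS = <<rows Y>>%VS.
Proof. by move=> XY; apply/vspaceP => v; rewrite !mem_span_rows XY. Qed.

Lemma dim_span_rows p (X : 'M[R]_(p, N)) : \dim <<rows X>> = \rank X.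
Proof.
rewrite -(eq_span_rows (eq_row_base X)).
have : free (rows (row_base X)) by rewrite free_rows row_base_free.
by rewrite /free size_tuple => /eqP.
Qed.

Definition basis_mx (W : {vspace 'rV[R]_N}) : 'M[R]_(\dim W, N) :=
  \matrix_i tnth (vbasis W) i.

Lemma rows_basis_mx W : rows (basis_mx W) = vbasis W.
Proof. by apply: eq_from_tnth => i; rewrite tnth_mktuple rowK. Qed.

Lemma span_basis_mx W : <<rows (basis_mx W)>>%VS = W.
Proof. by rewrite rows_basis_mx (span_basis (vbasisP W)). Qed.

Lemma basis_mx_free W : row_free (basis_mx W).
Proof. by rewrite -free_rows rows_basis_mx (basis_free (vbasisP W)). Qed.

(** The basis behind [basis_mx W] is arbitrary, but by [orthoproj_uniq] the projection does not
    depend on it; [orthoproj_span] computes it from any frame. *)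
Definition orthoproj W : 'M[R]_N := gram_proj (basis_mx W).

Lemma orthoproj_tr W : (orthoproj W)^T = orthoproj W.
Proof. exact: gram_proj_tr. Qed.

Lemma orthoprojK W : orthoproj W *m orthoproj W = orthoproj W.
Proof. exact/gram_projK/basis_mx_free. Qed.

Lemma orthoproj_eqmx W : (orthoproj W :=: basis_mx W)%MS.
Proof. exact/gram_proj_eqmx/basis_mx_free. Qed.

Lemma span_orthoproj W : <<rows (orthoproj W)>>%VS = W.
Proof. by rewrite (eq_span_rows (orthoproj_eqmx W)) span_basis_mx. Qed.

Lemma rank_orthoproj W : \rank (orthoproj W) = \dim W.
Proof. by rewrite -dim_span_rows span_orthoproj. Qed.

Lemma sub_orthoproj p W (X : 'M[R]_(p, N)) :
  (X <= orthoproj W)%MS = (X *m orthoproj W == X).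
Proof.
apply/idP/eqP => [/submxP[Y ->]|<-]; last exact: submxMl.
by rewrite -mulmxA orthoprojK.
Qed.

Lemma mem_orthoproj (W : {vspace 'rV[R]_N}) v : (v \in W) = (v *m orthoproj W == v).
Proof. by rewrite -sub_orthoproj -mem_span_rows span_orthoproj. Qed.

Lemma rows_sub_orthoproj p (W : {vspace 'rV[R]_N}) (X : 'M[R]_(p, N)) :
  (forall i, row i X \in W) <-> X *m orthoproj W = X.
Proof.
split=> [XW|XW i]; last by rewrite mem_orthoproj -row_mul XW.
by apply/row_matrixP => i; rewrite row_mul; apply/eqP; rewrite -mem_orthoproj.
Qed.

Lemma orthoproj_span_eqmx p (X : 'M[R]_(p, N)) :
  (orthoproj <<rows X>>%VS :=: X)%MS.
Proof.
apply/eqmxP/andP; split; apply/row_subP => i.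
  by rewrite -mem_span_rows mem_orthoproj -row_mul orthoprojK.
by rewrite -mem_span_rows span_orthoproj mem_span_rows row_sub.
Qed.

Lemma orthoproj_span p (X : 'M[R]_(p, N)) : row_free X ->
  orthoproj <<rows X>>%VS = gram_proj X.
Proof.
move=> fX; apply: orthoproj_uniq.
- exact: orthoproj_tr.
- exact: gram_proj_tr.
- exact: orthoprojK.
- exact: gram_projK.
- apply: (eqmx_trans (orthoproj_span_eqmx X)).
  exact/eqmx_sym/gram_proj_eqmx.
Qed.

(** Pythagoras: [sqnorm X] splits into the contributions of the projection and of its complement. *)
Lemma sqnorm_mulC_orthoproj p W (X : 'M[R]_(p, N)) :
  sqnorm (X *m (1%:M - orthoproj W)) <= sqnorm X.
Proof.
have trP : (1%:M - orthoproj W)^T = 1%:M - orthoproj W.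
  by rewrite linearB /= orthoproj_tr tr_scalar_mx.
have PP : (1%:M - orthoproj W) *m (1%:M - orthoproj W) = 1%:M - orthoproj W.
  rewrite mulmxBr mulmxBl !(mulmx1, mul1mx) mulmxBl mul1mx orthoprojK.
  by rewrite subrr subr0.
have -> : sqnorm X = sqnorm (X *m orthoproj W) +
    sqnorm (X *m (1%:M - orthoproj W)).
  have E (Q : 'M[R]_N) : Q^T = Q -> Q *m Q = Q ->
      sqnorm (X *m Q) = \tr (X *m Q *m X^T).
    by move=> tQ QQ; rewrite sqnormE trmx_mul tQ mulmxA -[X *m Q *m Q]mulmxA QQ.
  rewrite (E _ trP PP) E ?orthoproj_tr ?orthoprojK// sqnormE.
  rewrite -linearD/= -mulmxDl -mulmxDr.
  by rewrite addrC subrK mulmx1.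
by rewrite lerDr sqnorm_ge0.
Qed.

End RowSpan.

(** * Limits of matrices and of subspaces *)

Section MatrixLimits.
Variables (R : realType) (T : Type) (F : set_system T).
Context {FF : Filter F}.

Lemma cvg_mx p q (f : T -> 'M[R]_(p, q)) (M : 'M[R]_(p, q)) :
  (forall i j, f t i j @[t --> F] --> M i j) -> f t @[t --> F] --> M.
Proof.
move=> fM A [P MP PA].
have : \forall t \near F, forall i, forall j, P i j (f t i j).
  apply: filter_forall => i; apply: filter_forall => j.
  exact: fM (MP i j).
by apply: filterS => t Pt; apply: PA.
Qed.

Lemma cvg_mx_entry p q (f : T -> 'M[R]_(p, q)) (M : 'M[R]_(p, q)) i j :
  f t @[t --> F] --> M -> f t i j @[t --> F] --> M i j.
Proof.
move=> fM.
exact: (continuous_cvg _ (@coord_continuous _ _ _ i j M) fM).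
Qed.

Lemma cvg_mulmx p q r (f : T -> 'M[R]_(p, q)) (g : T -> 'M[R]_(q, r))
    (A : 'M[R]_(p, q)) (B : 'M[R]_(q, r)) :
  f t @[t --> F] --> A -> g t @[t --> F] --> B ->
  f t *m g t @[t --> F] --> A *m B.
Proof.
move=> fA gB; apply: cvg_mx => i k; rewrite mxE.
under eq_fun do rewrite mxE.
apply: cvg_big => [|j _]; first exact: add_continuous.
by apply: cvgM; exact: cvg_mx_entry.
Qed.

Lemma cvg_trmx p q (f : T -> 'M[R]_(p, q)) (A : 'M[R]_(p, q)) :
  f t @[t --> F] --> A -> (f t)^T @[t --> F] --> A^T.
Proof.
move=> fA; apply: cvg_mx => i j; rewrite mxE.
by under eq_fun do rewrite mxE; exact: cvg_mx_entry.
Qed.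

Lemma cvg_row_mx p q r (f : T -> 'M[R]_(p, q)) (g : T -> 'M[R]_(p, r))
    (A : 'M[R]_(p, q)) (B : 'M[R]_(p, r)) :
  f t @[t --> F] --> A -> g t @[t --> F] --> B ->
  row_mx (f t) (g t) @[t --> F] --> row_mx A B.
Proof.
move=> fA gB; apply: cvg_mx => i j; case: (splitP j) => k jk.
  have -> : j = lshift r k by exact: val_inj.
  by rewrite row_mxEl; under eq_fun do rewrite row_mxEl; exact: cvg_mx_entry.
have -> : j = rshift q k by exact: val_inj.
by rewrite row_mxEr; under eq_fun do rewrite row_mxEr; exact: cvg_mx_entry.
Qed.

Lemma cvg_col_mx p q r (f : T -> 'M[R]_(p, r)) (g : T -> 'M[R]_(q, r))
    (A : 'M[R]_(p, r)) (B : 'M[R]_(q, r)) :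
  f t @[t --> F] --> A -> g t @[t --> F] --> B ->
  col_mx (f t) (g t) @[t --> F] --> col_mx A B.
Proof.
move=> fA gB; rewrite -[col_mx A B]trmxK tr_col_mx.
under eq_fun do rewrite -[col_mx _ _]trmxK tr_col_mx.
by apply: cvg_trmx; apply: cvg_row_mx; exact: cvg_trmx.
Qed.

Lemma cvg_det n (f : T -> 'M[R]_n) (A : 'M[R]_n) :
  f t @[t --> F] --> A -> \det (f t) @[t --> F] --> \det A.
Proof.
move=> fA; apply: cvg_big => [|s _]; first exact: add_continuous.
apply: cvgM; first exact: cvg_cst.
by apply: cvg_big => [|i _]; [exact: mul_continuous|exact: cvg_mx_entry].
Qed.

Lemma near_unitmx n (f : T -> 'M[R]_n) (A : 'M[R]_n) :
  f t @[t --> F] --> A -> A \in unitmx -> \forall t \near F, f t \in unitmx.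
Proof.
rewrite unitmxE unitfE => /cvg_det fA A0.
have : \forall t \near F, \det (f t) != 0 by exact: (cvgr_neq0 _ fA).
by apply: filterS => t; rewrite unitmxE unitfE.
Qed.

(** Near a unit the inverse is the adjugate divided by the determinant, both polynomial in the
    entries. *)
Lemma cvg_invmx n (f : T -> 'M[R]_n) (A : 'M[R]_n) :
  f t @[t --> F] --> A -> A \in unitmx ->
  invmx (f t) @[t --> F] --> invmx A.
Proof.
move=> fA uA; apply: (cvg_trans (G := ((\det (f t))^-1 *: \adj (f t)) @[t --> F])).
  apply: near_eq_cvg; apply: filterS (near_unitmx fA uA) => t ut.
  by rewrite /invmx ut.
rewrite /invmx uA; apply: cvg_mx => i j; rewrite !mxE.
under eq_fun do rewrite !mxE.
apply: cvgM; first by apply: cvgV (cvg_det fA); rewrite -unitfE -unitmxE.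
apply: cvgM; first exact: cvg_cst.
apply: cvg_det; apply: cvg_mx => k l; rewrite !mxE.
by under eq_fun do rewrite !mxE; exact: cvg_mx_entry.
Qed.

Lemma cvg_sqnorm p q (f : T -> 'M[R]_(p, q)) (A : 'M[R]_(p, q)) :
  f t @[t --> F] --> A -> sqnorm (f t) @[t --> F] --> sqnorm A.
Proof.
move=> fA; apply: cvg_big => [|i _]; first exact: add_continuous.
apply: cvg_big => [|j _]; first exact: add_continuous.
by rewrite expr2; under eq_fun do rewrite expr2; apply: cvgM; exact: cvg_mx_entry.
Qed.

Lemma cvg_gram_proj p q (f : T -> 'M[R]_(p, q)) (A : 'M[R]_(p, q)) :
  f t @[t --> F] --> A -> row_free A ->
  gram_proj (f t) @[t --> F] --> gram_proj A.
Proof.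
rewrite row_free_gram => fA uA; apply: cvg_mulmx => //.
apply: cvg_mulmx; first exact: cvg_trmx.
by apply: cvg_invmx => //; apply: cvg_mulmx => //; exact: cvg_trmx.
Qed.

Lemma near_row_free p q (f : T -> 'M[R]_(p, q)) (A : 'M[R]_(p, q)) :
  f t @[t --> F] --> A -> row_free A -> \forall t \near F, row_free (f t).
Proof.
rewrite row_free_gram => fA uA.
have := near_unitmx (cvg_mulmx fA (cvg_trmx fA)) uA.
by apply: filterS => t; rewrite row_free_gram.
Qed.

End MatrixLimits.

Lemma set_val_continuous (X : topologicalType) (A : set X) :
  continuous (set_val : A -> X).
Proof. by apply/continuousP => B oB; exists B. Qed.

Lemma cvg_set_type (X : topologicalType) (A : set X) T (F : set_system T)
    {FF : Filter F} (f : T -> A) (x : A) :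
  set_val (f t) @[t --> F] --> set_val x -> f t @[t --> F] --> x.
Proof.
move=> fx U [_ [[B oB <-] Bx sBU]].
have : nbhs (set_val x) B by apply: open_nbhs_nbhs.
move=> /fx FB.
have : \forall t \near F, B (set_val (f t)) by [].
by apply: filterS => t Bt; apply: sBU.
Qed.

Section GrassmannianTopology.
Variables (R : realType) (N n : nat).
Implicit Types W : grassmannian R N n.

Lemma dim_grassmannian W : \dim W = n.
Proof. by case: W => W /= /eqP. Qed.

Lemma grassmannian_inj W W' : (W = W' :> {vspace _}) -> W = W'.
Proof. by move=> WW'; apply: val_inj. Qed.

(** In the quotient topology, continuity is tested on frames, where the projection is the explicit
    formula [gram_proj]. *)
Lemma orthoproj_continuous : continuous (fun W => orthoproj W).
Proof.
apply/continuousP => O oO; rewrite /open/= /grassmannian_open.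
have -> : (@frame_span R N n) @^-1` ((fun W => orthoproj W) @^-1` O) =
    (fun A : @frames R N n => gram_proj (set_val A)) @^-1` O.
  apply/seteqP; split=> A /=; rewrite orthoproj_span// -free_rows;
    exact: set_valP A.
move: O oO; apply/continuousP => A.
apply: cvg_gram_proj; [exact: nbhs_filter|exact: set_val_continuous|].
by rewrite -free_rows; exact: set_valP A.
Qed.

(** The spanning matrices may have more than [n] rows. A fixed [C] combines the rows of [Q0] into a
    frame [B] of [W]; near the limit [C *m Q t] is still row free, and having rank [n] it is a frame
    of [f t]. *)
Lemma cvg_grassmannian T (F : set_system T) {FF : Filter F} p
    (Q : T -> 'M[R]_(p, N)) (f : T -> grassmannian R N n) (Q0 : 'M[R]_(p, N)) W :
  Q t @[t --> F] --> Q0 -> (W = <<rows Q0>>%VS :> {vspace _}) ->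
  (\forall t \near F, f t = <<rows (Q t)>>%VS :> {vspace _}) ->
  f t @[t --> F] --> W.
Proof.
move=> QQ0 WQ0 fQ.
have rQ0 : \rank Q0 = n by rewrite -dim_span_rows -WQ0 dim_grassmannian.
have [B fB BQ0] : exists2 B : 'M[R]_(n, N), row_free B & (B :=: Q0)%MS.
  rewrite -rQ0; exists (row_base Q0); first exact: row_base_free.
  exact: eq_row_base.
have /submxP[C BC] : (B <= Q0)%MS by rewrite BQ0.
have CQ : C *m Q t @[t --> F] --> B.
  by rewrite BC; apply: cvg_mulmx => //; exact: cvg_cst.
have frB : @frames R N n B by rewrite /frames/= free_rows.
move=> U; rewrite nbhsE => -[V [oV VW] VU].
have [D oD DV] : exists2 D, open D & set_val @^-1` D = (@frame_span R N n) @^-1` V.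
  exact: oV.
have DB : D B.
  rewrite -[B]/(set_val (SigSub (mem_set frB) : @frames R N n)).
  rewrite -[D _]/((set_val @^-1` D) _) DV /=.
  suff -> : frame_span (SigSub (mem_set frB)) = W by [].
  by apply: grassmannian_inj; rewrite /= WQ0; exact: eq_span_rows.
have nD : \forall t \near F, D (C *m Q t).
  by apply: CQ; exact: open_nbhs_nbhs.
apply: filterS3 fQ (near_row_free CQ fB) nD => t ft fCQ DCQ; apply: VU.
have frC : @frames R N n (C *m Q t) by rewrite /frames/= free_rows.
have : (@frame_span R N n @^-1` V) (SigSub (mem_set frC)) by rewrite -DV.
rewrite /=; congr V; apply: grassmannian_inj => /=.
apply/eqP; rewrite eqEdim ft !dim_span_rows (eqP fCQ).
rewrite -dim_span_rows -ft dim_grassmannian leqnn andbT ft.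
by apply/subvP => v; rewrite !mem_span_rows => /submx_trans; apply; exact: submxMl.
Qed.

End GrassmannianTopology.

(** * Tilting a plane towards a choice of points *)

Section Tilt.
Variables (R : realType) (N k : nat).
Implicit Types (W : {vspace 'rV[R]_N}) (X : 'M[R]_(k, N)).

(* Orthogonal decomposition makes this matrix the identity on the complement
   of [X pi] in [W], while it sends [X pi] to [X], where [pi] is the orthogonal
   projection onto [W]. *)
Definition tilt W X : 'M[R]_N :=
  let B := X *m orthoproj W in
  orthoproj W + B^T *m invmx (B *m B^T) *m (X *m (1%:M - orthoproj W)).

Lemma mulC_orthoproj W : (1%:M - orthoproj W) *m orthoproj W = 0.
Proof. by rewrite mulmxBl mul1mx orthoprojK subrr. Qed.

(** With [P] the projection onto [W], [tilt *m P = P] and [P *m tilt = tilt], so each rank bounds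
    the other. *)
Lemma rank_tilt W X : \rank (tilt W X) = \dim W.
Proof.
rewrite -rank_orthoproj.
have tiltP : tilt W X *m orthoproj W = orthoproj W.
  by rewrite /tilt/= mulmxDl orthoprojK -!mulmxA mulC_orthoproj !mulmx0 addr0.
have Ptilt : orthoproj W *m tilt W X = tilt W X.
  rewrite /tilt/=; move: (orthoproj W) (orthoproj_tr W) (orthoprojK W) => P tP PP.
  rewrite [LHS]mulmxDr PP !mulmxA; congr (_ + _ *m _ *m _ *m _).
  by rewrite trmx_mul tP mulmxA PP.
apply/eqP; rewrite eqn_leq -{1}Ptilt mxrankM_maxl/=.
by rewrite -{1}tiltP mxrankM_maxl.
Qed.

(** With [P] the projection onto [W], multiplying [tilt W X] on the left by [X *m P] cancels the
    Gram matrix and leaves [X *m P + X *m (1 - P) = X]. *)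
Lemma sub_tilt W X : row_free (X *m orthoproj W) -> (X <= tilt W X)%MS.
Proof.
rewrite row_free_gram => u; apply/submxP; exists (X *m orthoproj W).
rewrite /tilt/=; move: (orthoproj W) (orthoprojK W) u => P PP u.
rewrite [RHS]mulmxDr -[X *m P *m P]mulmxA PP !mulmxA (mulmxV u) mul1mx.
by rewrite -mulmxDr addrC subrK mulmx1.
Qed.

Lemma tilt_id W X : X *m orthoproj W = X -> tilt W X = orthoproj W.
Proof. by move=> XW; rewrite /tilt/= mulmxBr mulmx1 XW subrr mulmx0 addr0. Qed.

Lemma cvg_tilt n T (F : set_system T) {FF : Filter F}
    (f : T -> grassmannian R N n) (x : T -> 'M[R]_(k, N))
    (W : grassmannian R N n) (X : 'M[R]_(k, N)) :
  f t @[t --> F] --> W -> x t @[t --> F] --> X ->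
  row_free (X *m orthoproj W) ->
  tilt (f t) (x t) @[t --> F] --> tilt W X.
Proof.
move=> fW xX; rewrite row_free_gram => u.
have pW : orthoproj (f t) @[t --> F] --> orthoproj W.
  exact: (continuous_cvg _ (@orthoproj_continuous _ _ _ W) fW).
have BW : x t *m orthoproj (f t) @[t --> F] --> X *m orthoproj W.
  exact: cvg_mulmx.
have XC : x t *m (1%:M - orthoproj (f t)) @[t --> F] --> X *m (1%:M - orthoproj W).
  by apply: cvg_mulmx => //; apply: cvgB => //; exact: cvg_cst.
exact: cvgD pW (cvg_mulmx (cvg_mulmx (cvg_trmx BW)
  (cvg_invmx (cvg_mulmx BW (cvg_trmx BW)) u)) XC).
Qed.

End Tilt.

(** * Homogeneous coordinates and the space of transversals *)

Section Homogeneous.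
Variables (R : realType) (d k : nat).

Definition hom (a : 'M[R]_(k, d)) : 'M[R]_(k, d + 1) := row_mx a (const_mx 1).

Lemma row_hom a i : row i (hom a) = row_mx (row i a) (const_mx 1).
Proof. by rewrite /hom row_row_mx row_const. Qed.

Lemma cvg_hom T (F : set_system T) {FF : Filter F} (f : T -> 'M[R]_(k, d))
    (a : 'M[R]_(k, d)) :
  f t @[t --> F] --> a -> hom (f t) @[t --> F] --> hom a.
Proof. by move=> fa; apply: cvg_row_mx => //; exact: cvg_cst. Qed.

Lemma hom_conv (a b : 'M[R]_(k, d)) t :
  hom ((1 - t) *: a + t *: b) = (1 - t) *: hom a + t *: hom b.
Proof.
rewrite /hom !scale_row_mx add_row_mx; congr row_mx.
by apply/matrixP => i j; rewrite !mxE !mulr1 subrK.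
Qed.

Lemma sqnorm_homB (a b : 'M[R]_(k, d)) : sqnorm (hom a - hom b) = sqnorm (a - b).
Proof.
rewrite /hom opp_row_mx add_row_mx subrr /sqnorm; apply: eq_bigr => i _.
rewrite big_split_ord/= [X in _ + X]big1 ?addr0.
  by apply: eq_bigr => j _; rewrite row_mxEl.
by move=> j _; rewrite row_mxEr mxE expr0n.
Qed.

End Homogeneous.

Section TransversalSpace.
Variables (R : realType) (d m k : nat) (A : 'I_k -> set 'rV[R]_d).

Definition choices : set 'M[R]_(k, d) := [set a | forall i, A i (row i a)].

Definition space_of (P : transversals m A) : grassmannian R (d + 1) (m + 1) :=
  set_val (set_val P).

Lemma space_of_inj : injective space_of.
Proof. by move=> P P' PP'; apply/val_inj/val_inj. Qed.

Lemma space_of_continuous : continuous space_of.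
Proof.
move=> P; apply: continuous_comp; exact: set_val_continuous.
Qed.

Lemma cvg_transversals T (F : set_system T) {FF : Filter F}
    (f : T -> transversals m A) P :
  space_of (f t) @[t --> F] --> space_of P -> f t @[t --> F] --> P.
Proof. by move=> fP; apply: cvg_set_type; apply: cvg_set_type. Qed.

Lemma plane_points_hom (Q : affine_plane R d m) (a : 'M[R]_(k, d)) :
  (forall i, plane_points Q (row i a)) <->
  hom a *m orthoproj (set_val Q) = hom a.
Proof.
by rewrite -rows_sub_orthoproj; split=> h i; have := h i;
  rewrite row_hom.
Qed.

Lemma transversal_choice P :
  exists2 a, choices a & hom a *m orthoproj (space_of P) = hom a.
Proof.
have /choice[x xP] : forall i, exists x, plane_points (set_val P) x /\ A i x.
  by move=> i; have [x] := set_valP P i; exists x.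
exists (\matrix_i x i); first by move=> i; rewrite rowK; exact: (xP i).2.
by apply/plane_points_hom => i; rewrite rowK; exact: (xP i).1.
Qed.

(** Since [0 < k], some chosen point lies in [W] at height 1, which keeps [W] out of the hyperplane
    at infinity. *)
Lemma transversal_of_space (W : grassmannian R (d + 1) (m + 1)) a :
  (0 < k)%N -> choices a -> hom a *m orthoproj W = hom a ->
  exists P, space_of P = W.
Proof.
move=> k0 Ka aW.
have WA : affine_plane_set (m := m) W.
  exists (row (Ordinal k0) a); rewrite /chart_points/= -row_hom.
  by move/rows_sub_orthoproj : aW.
pose Q : affine_plane R d m := SigSub (mem_set WA).
have QA : transversals m A Q.
  move=> i; exists (row i a); split; last exact: Ka.
  by move: i; apply/plane_points_hom.
by exists (SigSub (mem_set QA)).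
Qed.

Lemma tilted_transversal P a : (0 < k)%N -> choices a ->
    row_free (hom a *m orthoproj (space_of P)) ->
  exists P', space_of P' = <<rows (tilt (space_of P) (hom a))>>%VS :> {vspace _}.
Proof.
move=> k0 Ka fa.
have dW : \dim <<rows (tilt (space_of P) (hom a))>>%VS == (m + 1)%N.
  by rewrite dim_span_rows rank_tilt dim_grassmannian.
have [|P' P'W] := transversal_of_space (W := Grassmannian dW) k0 Ka.
  by apply/eqP; rewrite -sub_orthoproj orthoproj_span_eqmx sub_tilt.
by exists P'; rewrite P'W.
Qed.

End TransversalSpace.

(** * Regularized nearest choices *)

Lemma near_snd X T (G : set_system X) (F : set_system T) {FG : Filter G}
    (P : set T) :
  F P -> \forall z \near filter_prod G F, P z.2.
Proof. by move=> FP; exists (setT, P) => [|z []]//; split=> //; exact: filterT. Qed.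

(** Each [y] of [K] other than [x0] has a neighbourhood on which [phi t] eventually exceeds
    [phi t x0], a level between [psi x0] and [psi y] separating them. Compactness makes this uniform
    outside [U], so minimizers end up in [U]. *)
Lemma cvg_argmin (R : realType) (X : topologicalType) (K : set X) T
    (F : set_system T) {FF : Filter F} (phi : T -> X -> R) (psi : X -> R)
    (x : T -> X) (x0 : X) :
  compact K -> K x0 ->
  (forall y, K y -> phi z.2 z.1 @[z --> filter_prod (nbhs y) F] --> psi y) ->
  (forall y, K y -> y <> x0 -> psi x0 < psi y) ->
  (\forall t \near F, K (x t) /\ forall y, K y -> phi t (x t) <= phi t y) ->
  x t @[t --> F] --> x0.
Proof.
move=> cK Kx0 phipsi x0min xmin U Ux0.
suff : \forall t \near F, K `<=` [set y | U y \/ phi t x0 < phi t y].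
  apply: filterS2 xmin => t [Kxt xtmin] /(_ _ Kxt)[//|].
  by rewrite ltNge xtmin.
move/compact_near_coveringP : cK; apply => y Ky.
have [->|yx0] := pselect (y = x0).
  exists (U, setT) => /=; first by split => //; exact: filterT.
  by move=> z [/= Uz _]; left.
set c := 2^-1 * (psi x0 + psi y).
have psixy := x0min _ Ky yx0.
have xc : psi x0 < c by rewrite /c; lra.
have cy : c < psi y by rewrite /c; lra.
have [[B C] /= [x0B FC] BC] :
    \forall z \near filter_prod (nbhs x0) F, phi z.2 z.1 < c.
  exact: (cvgr_lt _ (phipsi _ Kx0)).
have phix0 : \forall z \near filter_prod (nbhs y) F, phi z.2 x0 < c.
  apply: (near_snd (P := fun t => phi t x0 < c)); apply: filterS FC => t Ct.
  by apply: (BC (x0, t)); split => //=; exact: nbhs_singleton.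
have phiy : \forall z \near filter_prod (nbhs y) F, c < phi z.2 z.1.
  exact: (cvgr_gt _ (phipsi _ Ky)).
apply: filterS2 phix0 phiy => z h1 h2; right.
exact: lt_trans h1 h2.
Qed.

Section CompactChoices.
Variables (R : realType) (d k : nat) (A : 'I_k -> set 'rV[R]_d).

Lemma compact_choices : (forall i, compact (A i)) -> compact (choices A).
Proof.
move=> cA; pose f (g : prod_topology (fun _ : 'I_k => 'rV[R]_d)) : 'M[R]_(k, d) :=
  \matrix_i g i.
pose K : set (prod_topology (fun _ : 'I_k => 'rV[R]_d)) :=
  [set g | forall i, A i (g i)].
have -> : choices A = f @` K.
  apply/seteqP; split=> [a Aa|_ [g Ag <-] i]; last by rewrite rowK; exact: Ag.
  exists (fun i => row i a); first exact: Aa.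
  by apply/row_matrixP => i; rewrite rowK.
apply: continuous_compact; last exact: tychonoff.
apply: continuous_subspaceT => g; apply: (@cvg_mx _ _ _ (nbhs_filter g)) => i j.
have -> : (fun h => f h i j) = (fun h => h i 0 j).
  by apply/funext => h; rewrite mxE.
rewrite mxE; apply: (@cvg_mx_entry _ _ _ (nbhs_filter g)).
exact: (@proj_continuous _ (fun _ : 'I_k => 'rV[R]_d) i g).
Qed.

Lemma choices_conv a b t : (forall i, convex_set (A i)) ->
  choices A a -> choices A b -> 0 <= t <= 1 ->
  choices A ((1 - t) *: a + t *: b).
Proof.
move=> convA Aa Ab /andP[t0 t1] i; rewrite linearP linearZ/= addrC.
have := convA i (row i b) (row i a) (Itv01 t0 t1) (mem_set (Ab i)) (mem_set (Aa i)).
by move=> /set_mem.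
Qed.

Hypothesis choices_compact : compact (choices A).
Hypothesis choices_free : forall a, choices A a -> row_free (hom a).

Lemma choices_sqnorm_bound alpha : choices A alpha ->
  exists2 C, 0 < C & forall a, choices A a -> sqnorm (a - alpha) <= C.
Proof.
move=> Aalpha.
have [||c _ cmax] := compact_EVT_max _ choices_compact
  (f := fun a : 'M[R]_(k, d) => sqnorm (a - alpha)).
- by exists alpha.
- apply: continuous_subspaceT => a; apply: (@cvg_sqnorm _ _ _ (nbhs_filter a)).
  exact: (cvgB (FF := nbhs_filter a) cvg_id (cvg_cst alpha)).
exists (sqnorm (c - alpha) + 1) => [|a Aa].
  by rewrite ltr_wpDl// sqnorm_ge0.
by apply: (le_trans (cmax a (mem_set Aa))); rewrite lerDl.
Qed.

(** Row freeness is an open condition and the choices are compact, so one bound on the perturbation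
    [Y] keeps every [hom a - Y] row free. It is applied to the component of [hom a] orthogonal to
    [W]. *)
Lemma row_free_near_choices : exists2 delta : R, 0 < delta &
  forall a (W : {vspace 'rV[R]_(d + 1)}), choices A a ->
    sqnorm (hom a *m (1%:M - orthoproj W)) < delta ->
    row_free (hom a *m orthoproj W).
Proof.
pose G := nbhs (0 : 'M[R]_(k, d + 1)).
have FG : Filter G := nbhs_filter _.
have : \forall Y \near G, choices A `<=` (fun a => row_free (hom a - Y)).
  move/compact_near_coveringP : choices_compact; apply => a Aa.
  have aY : hom z.1 - z.2 @[z --> filter_prod (nbhs a) G] --> hom a.
    rewrite -[X in _ --> X]subr0; apply: cvgB; last exact: cvg_snd.
    by apply: cvg_hom; exact: cvg_fst.
  exact: near_row_free aY (choices_free Aa).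
move=> /nbhs_ballP[e /= e0 eK].
(* Balls of matrices are entrywise while [sqnorm] is a squared norm dominating each squared
   entry. *)
exists (e ^+ 2); first by rewrite exprn_gt0.
move=> a W Aa ae.
have -> : hom a *m orthoproj W = hom a - hom a *m (1%:M - orthoproj W).
  by rewrite mulmxBr mulmx1 subKr.
apply: eK => //; split => // i j; rewrite /ball/= mxE sub0r normrN.
rewrite -(ltr_pXn2r (n := 2))// ?nnegrE ?ltW// real_normK ?num_real//.
exact: le_lt_trans (sqnorm_entry _ i j) ae.
Qed.

(** The points [x t] need not converge. Around a choice lying on [W], tilting is continuous with
    value the projection onto [W]; around any other choice the distance to [f t] stays bounded
    below, so [x t] eventually avoids it. Compactness of the choices combines the two cases. *)
Lemma cvg_tilt_near n T (F : set_system T) {FF : Filter F}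
    (f : T -> grassmannian R (d + 1) n) (x : T -> 'M[R]_(k, d))
    (W : grassmannian R (d + 1) n) :
  f t @[t --> F] --> W ->
  (\forall t \near F, choices A (x t)) ->
  sqnorm (hom (x t) *m (1%:M - orthoproj (f t))) @[t --> F] --> 0 ->
  tilt (f t) (hom (x t)) @[t --> F] --> orthoproj W.
Proof.
move=> fW Ax rx0 U UW.
pose dist (a : 'M[R]_(k, d)) t := sqnorm (hom a *m (1%:M - orthoproj (f t))).
(* The guard on [dist] holds trivially at [a = x t] and discards the choices that are far from the
   plane. *)
suff : \forall t \near F, choices A `<=`
    [set a | dist a t <= dist (x t) t -> U (tilt (f t) (hom a))].
  by apply: filterS2 Ax => t Axt /(_ _ Axt); exact.
move/compact_near_coveringP : choices_compact; apply => a Aa.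
have fW' : f z.2 @[z --> filter_prod (nbhs a) F] --> W.
  by apply: cvg_comp fW; exact: cvg_snd.
have homa : hom z.1 @[z --> filter_prod (nbhs a) F] --> hom a.
  by apply: cvg_hom; exact: cvg_fst.
have [aW|aW] := eqVneq (hom a *m (1%:M - orthoproj W)) 0.
  have {}aW : hom a *m orthoproj W = hom a.
    by apply/esym/eqP; rewrite -subr_eq0 -{1}[hom a]mulmx1 -mulmxBr aW.
  have : tilt (f z.2) (hom z.1) @[z --> filter_prod (nbhs a) F] --> tilt W (hom a).
    by apply: cvg_tilt => //; rewrite aW choices_free.
  rewrite tilt_id// => /(_ _ UW) nU.
  have : \forall z \near filter_prod (nbhs a) F, U (tilt (f z.2) (hom z.1)) by [].
  by apply: filterS => z Uz _.
have {}aW : 0 < sqnorm (hom a *m (1%:M - orthoproj W)).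
  by rewrite lt_neqAle sqnorm_ge0 eq_sym sqnorm_eq0 aW.
set e := sqnorm _ in aW.
have dista : dist z.1 z.2 @[z --> filter_prod (nbhs a) F] --> e.
  apply: cvg_sqnorm; apply: cvg_mulmx => //; apply: cvgB; first exact: cvg_cst.
  exact: (continuous_cvg _ (@orthoproj_continuous _ _ _ W) fW').
have h1 : \forall z \near filter_prod (nbhs a) F, e / 2 < dist z.1 z.2.
  by apply: (cvgr_gt _ dista); lra.
have h2 : \forall z \near filter_prod (nbhs a) F, dist (x z.2) z.2 < e / 2.
  apply: (near_snd (P := fun t => dist (x t) t < e / 2)).
  by apply: (cvgr_lt _ rx0); lra.
by apply: filterS2 h1 h2 => z z1 z2 z3; lra.
Qed.

End CompactChoices.

Section Argmin.
Variables (R : realType) (d k : nat) (A : 'I_k -> set 'rV[R]_d).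
Variable alpha : 'M[R]_(k, d).
Hypothesis choices_compact : compact (choices A).
Hypothesis A_convex : forall i, convex_set (A i).
Hypothesis Aalpha : choices A alpha.

(* The penalty [s * |a - alpha|^2] makes the nearest choice of points to [W]
   unique, hence continuous in [W] as long as [s > 0]. *)
Definition cost (W : {vspace 'rV[R]_(d + 1)}) s a : R :=
  sqnorm (hom a *m (1%:M - orthoproj W)) + s * sqnorm (a - alpha).

Definition minimizer W s a :=
  choices A a /\ forall b, choices A b -> cost W s a <= cost W s b.

Lemma cvg_cost n T (F : set_system T) {FF : Filter F}
    (f : T -> grassmannian R (d + 1) n) (W : grassmannian R (d + 1) n)
    (x : T -> 'M[R]_(k, d)) (a : 'M[R]_(k, d)) (s : T -> R) (s0 : R) :
  f t @[t --> F] --> W -> x t @[t --> F] --> a -> s t @[t --> F] --> s0 ->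
  cost (f t) (s t) (x t) @[t --> F] --> cost W s0 a.
Proof.
move=> fW xa ss0; apply: cvgD; last first.
  by apply: cvgM => //; apply: cvg_sqnorm; apply: cvgB => //; exact: cvg_cst.
apply: cvg_sqnorm; apply: cvg_mulmx; first exact: cvg_hom.
apply: cvgB; first exact: cvg_cst.
exact: (continuous_cvg _ (@orthoproj_continuous _ _ _ W) fW).
Qed.

Lemma minimizer_exists n (W : grassmannian R (d + 1) n) s :
  exists a, minimizer W s a.
Proof.
have [||a /set_mem Aa amin] := compact_EVT_min _ choices_compact (f := cost W s).
- by exists alpha.
- apply: continuous_subspaceT => a.
  exact: (cvg_cost (FF := nbhs_filter a) (cvg_cst W) cvg_id (cvg_cst s)).
by exists a; split=> // b Ab; apply: amin; exact: mem_set.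
Qed.

(** Strict convexity: by the parallelogram identity the midpoint [c] of [a] and [b] costs less than
    the average of their costs by at least [s / 4] times [sqnorm (a - b)]. *)
Lemma minimizer_unique W s a b : 0 < s -> minimizer W s a ->
  choices A b -> b <> a -> cost W s a < cost W s b.
Proof.
move=> s0 [Aa amin] Ab ba; rewrite ltNge; apply/negP => cba.
have [c cE] : exists c : 'M[R]_(k, d), c = (1 - 2^-1) *: a + 2^-1 *: b by eexists.
have Ac : choices A c by rewrite cE; apply: choices_conv => //; lra.
have := amin _ Ac; apply/negP; rewrite -ltNge.
have -> : cost W s c = 2^-1 * (cost W s a + cost W s b) -
    4^-1 * (sqnorm ((hom a - hom b) *m (1%:M - orthoproj W)) + s * sqnorm (a - b)).
  rewrite /cost (_ : hom c = (1 - 2^-1) *: hom a + 2^-1 *: hom b); last first.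
    by rewrite cE hom_conv.
  have -> : ((1 - 2^-1) *: hom a + 2^-1 *: hom b) *m (1%:M - orthoproj W) =
      2^-1 *: (hom a *m (1%:M - orthoproj W) + hom b *m (1%:M - orthoproj W)).
    by rewrite mulmxDl -!scalemxAl scalerDr; congr (_ *: _ + _); field.
  have -> : c - alpha = 2^-1 *: ((a - alpha) + (b - alpha)).
    by apply/matrixP => i j; rewrite cE !mxE; field.
  have E : (a - alpha) - (b - alpha) = a - b by rewrite opprB addrA subrK.
  by rewrite !sqnorm_midpoint E -mulmxBl; field.
have : 0 < sqnorm (a - b).
  rewrite lt_neqAle sqnorm_ge0 eq_sym sqnorm_eq0 subr_eq0 eq_sym andbT.
  exact/eqP.
move=> /(mulr_gt0 s0).
have := sqnorm_ge0 ((hom a - hom b) *m (1%:M - orthoproj W)).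
by lra.
Qed.

Lemma cvg_minimizer n T (F : set_system T) {FF : Filter F}
    (f : T -> grassmannian R (d + 1) n) (W : grassmannian R (d + 1) n)
    (x : T -> 'M[R]_(k, d)) (a : 'M[R]_(k, d)) (s : T -> R) (s0 : R) :
  f t @[t --> F] --> W -> s t @[t --> F] --> s0 -> 0 < s0 ->
  (\forall t \near F, minimizer (f t) (s t) (x t)) -> minimizer W s0 a ->
  x t @[t --> F] --> a.
Proof.
move=> fW ss0 s0_gt0 xmin amin.
apply: (cvg_argmin (phi := fun t => cost (f t) (s t)) (psi := cost W s0)
  choices_compact).
- by case: amin.
- move=> y Ay; apply: cvg_cost.
  + by apply: cvg_comp fW; exact: cvg_snd.
  + exact: cvg_fst.
  + by apply: cvg_comp ss0; exact: cvg_snd.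
- by move=> y; exact: minimizer_unique.
- by apply: filterS xmin.
Qed.

(** A choice [b] lying on [W] pays only the penalty, at most [s * C], and the minimizer costs no
    more. *)
Lemma minimizer_sqnorm W s a C : 0 <= s -> minimizer W s a ->
  (forall b, choices A b -> sqnorm (b - alpha) <= C) ->
  (exists2 b, choices A b & hom b *m orthoproj W = hom b) ->
  sqnorm (hom a *m (1%:M - orthoproj W)) <= s * C.
Proof.
move=> s0 [Aa amin] bC [b Ab bW]; have := amin _ Ab.
rewrite /cost [X in _ <= X + _](_ : _ = 0); last first.
  by apply/eqP; rewrite sqnorm_eq0 mulmxBr mulmx1 bW subrr.
rewrite add0r; have := ler_wpM2l s0 (bC _ Ab).
have := mulr_ge0 s0 (sqnorm_ge0 (a - alpha)).
by lra.
Qed.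

(** Here [alpha] costs 0, so a minimizer different from [alpha] would have negative cost. *)
Lemma minimizer_alpha W s a : 0 < s -> minimizer W s a ->
  hom alpha *m orthoproj W = hom alpha -> a = alpha.
Proof.
move=> s0 amin aW; apply: contrapT => aalpha.
have := minimizer_unique s0 amin Aalpha (nesym aalpha).
have -> : cost W s alpha = 0.
  by rewrite /cost mulmxBr mulmx1 aW !subrr !sqnorm0 mulr0 addr0.
by rewrite ltNge addr_ge0 ?mulr_ge0 ?sqnorm_ge0// ltW.
Qed.

End Argmin.

(** * Deformations *)

Lemma continuous_pair (X Y Z : topologicalType) (f : X -> Y) (g : X -> Z) x :
  {for x, continuous f} -> {for x, continuous g} ->
  {for x, continuous (fun y => (f y, g y))}.
Proof.
move=> cf cg U [[B C] /= [/cf nB /cg nC] BCU].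
have nB' : \forall y \near x, B (f y) by [].
have nC' : \forall y \near x, C (g y) by [].
by apply: filterS2 nB' nC' => y By Cy; apply: BCU.
Qed.

Section Deformation.
Variable R : realType.

(* Homotopies that are stationary outside of [0, 1], so that continuity holds on
   the whole of [X * R] and pasting needs no subspace topology. *)
Definition deformation (X Y : topologicalType) (f g : X -> Y) :=
  exists H : X * R -> Y, [/\ continuous H,
    forall x t, t <= 0 -> H (x, t) = f x & forall x t, 1 <= t -> H (x, t) = g x].

Variables X Y : topologicalType.
Implicit Types f g h : X -> Y.

Lemma deformation_homotopic f g : deformation f g -> homotopic R f g.
Proof.
case=> H [cH Hf Hg]; exists H; split=> [|x|x]; [|exact: Hf|exact: Hg].
exact: continuous_subspaceT.
Qed.

Lemma deformation_continuous f g : deformation f g -> continuous g.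
Proof.
case=> H [cH _ Hg] x.
have -> : g = (fun y => H (y, 1)) by apply/funext => y; rewrite Hg.
apply: (continuous_comp (f := fun y => (y, 1 : R))); last exact: cH.
by apply: continuous_pair; [exact: cvg_id|exact: cvg_cst].
Qed.

Lemma deformation_sym f g : deformation f g -> deformation g f.
Proof.
case=> H [cH Hf Hg]; exists (fun z => H (z.1, 1 - z.2)).
split=> [z|x t t0|x t t1] /=.
- apply: (continuous_comp (f := fun z : X * R => (z.1, 1 - z.2))); last exact: cH.
  apply: continuous_pair; first exact: cvg_fst.
  by apply: cvgB; [exact: cvg_cst|exact: cvg_snd].
- by apply: Hg; lra.
- by apply: Hf; lra.
Qed.

Lemma deformation_trans f g h :
  deformation f g -> deformation g h -> deformation f h.
Proof.
move=> [H [cH Hf Hg]] [K [cK Kg Kh]].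
(* [L] runs through [H] on [0, 1] and [K] on [1, 2]; time is rescaled at the end. *)
pose L z := if z.2 <= 1 then H z else K (z.1, z.2 - 1).
have cL : continuous L.
  move=> [x t].
  have cK' : {for (x, t), continuous (fun z : X * R => K (z.1, z.2 - 1))}.
    apply: (continuous_comp (f := fun z : X * R => (z.1, z.2 - 1))); last exact: cK.
    apply: continuous_pair; first exact: cvg_fst.
    by apply: cvgB; [exact: cvg_snd|exact: cvg_cst].
  have snd_t : snd z @[z --> (x, t)] --> t by exact: cvg_snd.
  have [t1|t1|t1] := ltgtP t 1.
  - have n1 : \forall z \near (x, t), snd z < 1 by exact: (cvgr_lt _ snd_t).
    rewrite /continuous_at {2}/L /= (ltW t1).
    apply: cvg_trans (cH (x, t)); apply: near_eq_cvg.
    by apply: filterS n1 => z z1; rewrite /L ltW.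
  - have n1 : \forall z \near (x, t), 1 < snd z by exact: (cvgr_gt _ snd_t).
    rewrite /continuous_at {2}/L /= leNgt t1 /=.
    apply: cvg_trans cK'; apply: near_eq_cvg.
    by apply: filterS n1 => z z1; rewrite /L leNgt z1.
  (* At the junction both branches are continuous with the same value, so a neighbourhood of it
     contains nearby values whichever branch is taken. *)
  - have HK : H (x, t) = K (x, t - 1) by rewrite Hg ?t1// Kg// subrr.
    rewrite /continuous_at {2}/L /= t1 lexx -t1 => U UH.
    have nH : \forall z \near (x, t), U (H z) by exact: cH.
    rewrite HK in UH.
    have nK : \forall z \near (x, t), U (K (z.1, z.2 - 1)) by exact: cK'.
    by apply: filterS2 nH nK => z Hz Kz; rewrite /L /=; case: (z.2 <= 1).
exists (fun z => L (z.1, 2 * z.2)); split=> [z|x t t0|x t t1].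
- apply: (continuous_comp (f := fun z : X * R => (z.1, 2 * z.2))); last exact: cL.
  apply: continuous_pair; first exact: cvg_fst.
  by apply: cvgM; [exact: cvg_cst|exact: cvg_snd].
- by rewrite /L/= ifT ?Hf//; lra.
- by rewrite /L/= ifF ?Kh//; [lra|apply/negbTE; lra].
Qed.

End Deformation.

Section Clamp.
Variable R : realType.

Definition clamp (t : R) : R := Num.max 0 (Num.min t 1).

Lemma clamp_itv t : 0 <= clamp t <= 1.
Proof.
by apply/andP; rewrite /clamp; split;
  (case: (leP t 1) => ?; [case: (leP 0 t)|case: (leP 0 1)] => ?; lra).
Qed.

Lemma clamp_le0 t : t <= 0 -> clamp t = 0.
Proof.
move=> ?; rewrite /clamp.
by case: (leP t 1) => ?; [case: (leP 0 t)|case: (leP 0 1)] => ?; lra.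
Qed.

Lemma clamp_ge1 t : 1 <= t -> clamp t = 1.
Proof.
move=> ?; rewrite /clamp.
by case: (leP t 1) => ?; [case: (leP 0 t)|case: (leP 0 1)] => ?; lra.
Qed.

Lemma clamp_gt0 t : 0 < t -> 0 < clamp t.
Proof.
move=> ?; rewrite /clamp.
by case: (leP t 1) => ?; [case: (leP 0 t)|case: (leP 0 1)] => ?; lra.
Qed.

(** This closed form makes continuity immediate. *)
Lemma clampE t : clamp t = 2^-1 * (1 + `|t| - `|1 - t|).
Proof.
rewrite /clamp; case: (leP t 1) => ?; case: leP => ?;
 case: (ger0P t) => ?; case: (ger0P (1 - t)) => ?; lra.
Qed.

Lemma clamp_continuous : continuous clamp.
Proof.
move=> t; rewrite (_ : clamp = fun t => 2^-1 * (1 + `|t| - `|1 - t|)); last first.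
  by apply/funext => x; exact: clampE.
apply: cvgM; first exact: cvg_cst.
apply: cvgB; last by apply: cvg_norm; apply: cvgB; [exact: cvg_cst|exact: cvg_id].
by apply: cvgD; [exact: cvg_cst|apply: cvg_norm; exact: cvg_id].
Qed.

End Clamp.

(** * The deformation retraction onto planes through alpha *)

Section Retraction.
Variables (R : realType) (d m k : nat) (A : 'I_k -> set 'rV[R]_d).
Variable alpha : 'M[R]_(k, d).
Hypothesis k_gt0 : (0 < k)%N.
Hypothesis choices_compact : compact (choices A).
Hypothesis choices_free : forall a, choices A a -> row_free (hom a).
Hypothesis A_convex : forall i, convex_set (A i).
Hypothesis Aalpha : choices A alpha.

Local Notation TA := (transversals m A).
Implicit Types P : TA.

Definition through P (a : 'M[R]_(k, d)) := hom a *m orthoproj (space_of P) = hom a.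

(** A relation rather than a function, because the tilted subspace is known to be a transversal only
    under the hypotheses of [tilted_transversal]. *)
Definition tilted P (a : 'M[R]_(k, d)) P' :=
  space_of P' = <<rows (tilt (space_of P) (hom a))>>%VS :> {vspace _}.

Lemma tilted_id P a P' : through P a -> tilted P a P' -> P' = P.
Proof.
move=> Pa PP'; apply/space_of_inj/grassmannian_inj.
by rewrite PP' tilt_id// span_orthoproj.
Qed.

Lemma tilted_through P a P' : row_free (hom a *m orthoproj (space_of P)) ->
  tilted P a P' -> through P' a.
Proof.
move=> fa PP'; apply/eqP; rewrite -sub_orthoproj PP' orthoproj_span_eqmx.
exact: sub_tilt.
Qed.

Lemma cvg_tilted T (F : set_system T) {FF : Filter F} (f g : T -> TA)
    (a : T -> 'M[R]_(k, d)) (b : 'M[R]_(k, d)) P P' :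
  f t @[t --> F] --> P -> a t @[t --> F] --> b ->
  row_free (hom b *m orthoproj (space_of P)) -> tilted P b P' ->
  (\forall t \near F, tilted (f t) (a t) (g t)) -> g t @[t --> F] --> P'.
Proof.
move=> fP ab fb PP' fag; apply: cvg_transversals.
apply: (cvg_grassmannian
  (Q := fun t => tilt (space_of (f t)) (hom (a t))) _ PP') => //.
apply: cvg_tilt => //; last exact: cvg_hom.
exact: (continuous_cvg _ (@space_of_continuous _ _ _ _ _ P) fP).
Qed.

(** At time [t] the plane is tilted to the minimizer with penalty [eps * clamp t]; [c P] is the
    minimizer reached at time 1. *)
Lemma retraction_onto_close_choices delta : 0 < delta ->
  (forall a (W : {vspace 'rV[R]_(d + 1)}), choices A a ->
    sqnorm (hom a *m (1%:M - orthoproj W)) < delta ->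
    row_free (hom a *m orthoproj W)) ->
  exists (r : TA -> TA) (c : TA -> 'M[R]_(k, d)),
  [/\ deformation R idfun r, continuous c, forall P, choices A (c P),
      forall P, through (r P) (c P) &
      forall P, through P alpha -> r P = P /\ c P = alpha].
Proof.
move=> delta0 near_free.
have [C C0 AC] := choices_sqnorm_bound choices_compact Aalpha.
(* Then [eps * C = delta / 2], so by [minimizer_sqnorm] every minimizer in use is close enough to
   its plane for tilting. *)
pose eps := delta / (2 * C).
have eps0 : 0 < eps by rewrite divr_gt0// mulr_gt0.
pose s (z : TA * R) := eps * clamp z.2.
have s_cont : continuous s.
  move=> z; apply: cvgM; first exact: cvg_cst.
  by apply: continuous_comp; [exact: cvg_snd|exact: clamp_continuous].
have s_gt0 (z : TA * R) : 0 < z.2 -> 0 < s z.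
  by move=> z0; rewrite mulr_gt0// clamp_gt0.
have s_ge0 (z : TA * R) : 0 <= s z.
  by have /andP[? _] := clamp_itv z.2; apply: mulr_ge0 => //; exact: ltW.
have [a amin] := choice (fun z : TA * R =>
  minimizer_exists choices_compact Aalpha (space_of z.1) (s z)).
have a_sqnorm (z : TA * R) :
    sqnorm (hom (a z) *m (1%:M - orthoproj (space_of z.1))) <= s z * C.
  by apply: (minimizer_sqnorm _ (amin z)) => //; exact: transversal_choice.
have a_free (z : TA * R) : row_free (hom (a z) *m orthoproj (space_of z.1)).
  apply: near_free; first by case: (amin z).
  apply: le_lt_trans (a_sqnorm z) _.
  have /andP[c0 c1] := clamp_itv z.2.
  apply: (@le_lt_trans _ _ (eps * C)).
    by apply: ler_wpM2r; [exact: ltW|rewrite /s ler_piMr// ltW].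
  by rewrite /eps invfM mulrA mulfVK ?gt_eqF// ltr_pdivrMr// ltr_pMr// ltr1n.
have space_cont (z : TA * R) : space_of w.1 @[w --> z] --> space_of z.1.
  by apply: continuous_comp; [exact: cvg_fst|exact: space_of_continuous].
have a_cont (z : TA * R) : 0 < z.2 -> a w @[w --> z] --> a z.
  move=> z0; apply: (cvg_minimizer choices_compact A_convex (space_cont z)
    (s_cont z) (s_gt0 _ z0) _ (amin z)).
  by apply: nearW => w; exact: amin.
(* For nonpositive times the penalty vanishes and minimizers may not be unique, so [H] is set to the
   identity there. *)
have /choice[H HE] : forall z : TA * R, exists P',
    if 0 < z.2 then tilted z.1 (a z) P' else P' = z.1.
  move=> z; case: (0 < z.2); last by exists z.1.
  by apply: tilted_transversal => //; case: (amin z).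
have H_pos (z : TA * R) : 0 < z.2 -> tilted z.1 (a z) (H z).
  by move=> z0; have := HE z; rewrite z0.
have H_npos (z : TA * R) : z.2 <= 0 -> H z = z.1.
  by move=> z0; have := HE z; rewrite ltNge z0.
have H_cont : continuous H.
  move=> z.
  have snd_z : snd w @[w --> z] --> z.2 by exact: cvg_snd.
  have fst_z : fst w @[w --> z] --> z.1 by exact: cvg_fst.
  have [z0|z0|z0] := ltgtP z.2 0.
  - rewrite /continuous_at H_npos ?ltW//.
    apply: cvg_trans fst_z; apply: near_eq_cvg.
    have : \forall w \near z, snd w < 0 by exact: (cvgr_lt _ snd_z).
    by apply: filterS => w w0; rewrite H_npos// ltW.
  - apply: (cvg_tilted fst_z (a_cont _ z0) (a_free z) (H_pos _ z0)).
    have : \forall w \near z, 0 < snd w by exact: (cvgr_gt _ snd_z).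
    by apply: filterS => w; exact: H_pos.
  - rewrite /continuous_at H_npos ?z0//; apply: cvg_transversals.
    (* At time 0 the minimizers may fail to converge, but their squared distance to the plane is at
       most [s w * C], which tends to 0. Both branches of [Q] therefore tend to the projection onto
       the plane. *)
    pose Q (w : TA * R) := if 0 < w.2 then tilt (space_of w.1) (hom (a w))
      else orthoproj (space_of w.1).
    apply: (cvg_grassmannian (Q := Q) (Q0 := orthoproj (space_of z.1))).
    + have tilt_z : tilt (space_of w.1) (hom (a w)) @[w --> z] -->
          orthoproj (space_of z.1).
        apply: (cvg_tilt_near choices_compact choices_free (space_cont z)).
          by apply: nearW => w; case: (amin w).
        have sC : s w * C @[w --> z] --> 0.
          rewrite [X in _ --> X](_ : _ = s z * C); last first.
            by rewrite /s z0 clamp_le0// mulr0 mul0r.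
          by apply: cvgM; [exact: s_cont|exact: cvg_cst].
        apply: (squeeze_cvgr _ (cvg_cst 0) sC).
        by apply: nearW => w; rewrite sqnorm_ge0 a_sqnorm.
      have proj_z : orthoproj (space_of w.1) @[w --> z] -->
          orthoproj (space_of z.1).
        exact: (continuous_cvg _ (@orthoproj_continuous _ _ _ _) (space_cont z)).
      move=> U Uz.
      have n1 : \forall w \near z, U (tilt (space_of w.1) (hom (a w))).
        exact: tilt_z.
      have n2 : \forall w \near z, U (orthoproj (space_of w.1)) by exact: proj_z.
      by apply: filterS2 n1 n2 => w w1 w2; rewrite /Q /=; case: (0 < w.2).
    + by rewrite span_orthoproj.
    + apply: nearW => w; rewrite /Q; case: ifPn => w0; first exact: H_pos.
      by rewrite H_npos ?span_orthoproj// leNgt.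
pose r P := H (P, 1); pose c P := a (P, 1).
exists r, c; split.
- exists H; split=> // [P t t0|P t t1]; first exact: H_npos.
  (* The penalties agree by clamping, but [a] comes from a choice function, so equality of its
     values requires uniqueness of minimizers. *)
  have aE : a (P, t) = a (P, 1).
    apply: contrapT => aa.
    have sE : s (P, t) = s (P, 1) by rewrite /s/= !clamp_ge1.
    have s1 : 0 < s (P, 1) by exact: s_gt0.
    have m1 := amin (P, 1); have mt := amin (P, t); rewrite sE in mt.
    have := minimizer_unique A_convex s1 m1 mt.1 aa.
    by rewrite ltNge mt.2//; exact: m1.1.
  apply/space_of_inj/grassmannian_inj; rewrite /r H_pos//; last first.
    exact: lt_le_trans t1.
  by rewrite aE H_pos.
- move=> P; apply: (continuous_comp (f := fun P => (P, 1 : R))); last exact: a_cont.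
  apply: (@continuous_pair TA TA R idfun (fun=> 1)); first exact: cvg_id.
  exact: cst_continuous.
- by move=> P; case: (amin (P, 1)).
- by move=> P; apply: (tilted_through (a_free (P, 1))); exact: H_pos.
- move=> P Palpha.
  have cE : c P = alpha.
    by apply: (minimizer_alpha A_convex Aalpha _ (amin (P, 1))) => //; exact: s_gt0.
  split=> //; apply: (tilted_id Palpha).
  by rewrite -cE; exact: H_pos.
Qed.

(** The plane [r P] stays the base of all tilts while the target moves from [c P] to [c' P]. As
    [r P] contains [c P], the component of the target orthogonal to [r P] comes only from a multiple
    of [c' P - c P], hence stays below [delta]. *)
Lemma deformation_step delta (r : TA -> TA) (c c' : TA -> 'M[R]_(k, d)) :
  (forall a (W : {vspace 'rV[R]_(d + 1)}), choices A a ->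
    sqnorm (hom a *m (1%:M - orthoproj W)) < delta ->
    row_free (hom a *m orthoproj W)) ->
  continuous r -> continuous c -> continuous c' ->
  (forall P, choices A (c P)) -> (forall P, choices A (c' P)) ->
  (forall P, sqnorm (c' P - c P) < delta) -> (forall P, through (r P) (c P)) ->
  exists r', [/\ deformation R r r', forall P, through (r' P) (c' P) &
    forall P, c P = c' P -> r' P = r P].
Proof.
move=> near_free r_cont c_cont c'_cont Ac Ac' cc' rc.
pose a (z : TA * R) : 'M[R]_(k, d) :=
  (1 - clamp z.2) *: c z.1 + clamp z.2 *: c' z.1.
have Aa z : choices A (a z) by apply: choices_conv => //; exact: clamp_itv.
have a_free (z : TA * R) : row_free (hom (a z) *m orthoproj (space_of (r z.1))).
  apply: near_free => //.
  have -> : hom (a z) *m (1%:M - orthoproj (space_of (r z.1))) =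
      clamp z.2 *: ((hom (c' z.1) - hom (c z.1)) *m
        (1%:M - orthoproj (space_of (r z.1)))).
    have rc0 : hom (c z.1) *m (1%:M - orthoproj (space_of (r z.1))) = 0.
      by rewrite mulmxBr mulmx1 rc subrr.
    by rewrite /a hom_conv mulmxDl mulmxBl -!scalemxAl rc0 scaler0 add0r subr0.
  rewrite sqnormZ; apply: le_lt_trans (cc' z.1); rewrite -sqnorm_homB.
  apply: le_trans (sqnorm_mulC_orthoproj (space_of (r z.1)) _).
  rewrite ler_piMl ?sqnorm_ge0//.
  by have /andP[? ?] := clamp_itv z.2; rewrite expr_le1.
have [H HE] := choice (fun z : TA * R =>
  tilted_transversal k_gt0 (Aa z) (a_free z)).
have a_cont : continuous a.
  have clamp_cont (z : TA * R) : clamp w.2 @[w --> z] --> clamp z.2.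
    by apply: continuous_comp; [exact: cvg_snd|exact: clamp_continuous].
  move=> z.
  have clampC : 1 - clamp w.2 @[w --> z] --> 1 - clamp z.2.
    by apply: (cvgB (FF := nbhs_filter z)); [exact: cvg_cst|exact: clamp_cont].
  have cz : c w.1 @[w --> z] --> c z.1.
    by apply: continuous_comp; [exact: cvg_fst|exact: c_cont].
  have c'z : c' w.1 @[w --> z] --> c' z.1.
    by apply: continuous_comp; [exact: cvg_fst|exact: c'_cont].
  exact: cvgD (cvgZ clampC cz) (cvgZ (clamp_cont z) c'z).
have a1 P t : 1 <= t -> a (P, t) = c' P.
  by move=> t1; rewrite /a/= clamp_ge1// subrr scale0r scale1r add0r.
have a0 P t : t <= 0 -> a (P, t) = c P.
  by move=> t0; rewrite /a/= clamp_le0// subr0 scale0r scale1r addr0.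
exists (fun P => H (P, 1)); split.
- exists H; split=> [z|P t t0|P t t1].
  + have rz : r w.1 @[w --> z] --> r z.1.
      by apply: continuous_comp; [exact: cvg_fst|exact: r_cont].
    apply: (cvg_tilted rz (a_cont z) (a_free z) (HE z)).
    by apply: nearW => w; exact: HE.
  + apply: (tilted_id (a := a (P, t))); last exact: HE.
    by rewrite a0//; exact: rc.
  + apply/space_of_inj/grassmannian_inj.
    by rewrite (HE (P, t)) (HE (P, 1)) !a1.
- move=> P; rewrite -(a1 P 1)//.
  by apply: (tilted_through (a_free (P, 1))); exact: HE.
- move=> P ccP; apply: (tilted_id (a := a (P, 1))); last exact: HE.
  by rewrite a1// -ccP; exact: rc.
Qed.

(** After the retraction onto close choices, the segment from [c P] to [alpha] is divided into [N]
    equal parts and [deformation_step] is applied to each. If [P] passes through [alpha], then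
    [c P = alpha] and every step fixes it. *)
Lemma deformation_retraction : exists r : TA -> TA,
  [/\ deformation R idfun r, forall P, through (r P) alpha &
      forall P, through P alpha -> r P = P].
Proof.
have [delta delta0 near_free] := row_free_near_choices choices_compact choices_free.
have [r [c [rdef c_cont Ac rc rcalpha]]] :=
  retraction_onto_close_choices delta0 near_free.
have [C C0 AC] := choices_sqnorm_bound choices_compact Aalpha.
(* A step has squared length at most [C / N ^ 2], so this [N] serves all planes at once. *)
have [N N0 NC] : exists2 N : nat, (0 < N)%N & C / N%:R ^+ 2 < delta.
  have [N CN] : exists N : nat, C / delta < N%:R.
    by exists (Num.bound (C / delta)); rewrite archi_boundP// divr_ge0// ltW.
  exists N.+1 => //; rewrite ltr_pdivrMr ?exprn_gt0// mulrC -ltr_pdivrMr//.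
  apply: (lt_le_trans CN); rewrite -natrX ler_nat.
  by rewrite (leq_trans (leqnSn _))// -[X in (X <= _)%N]expn1 leq_pexp2l.
have NR0 : N%:R != 0 :> R by rewrite pnatr_eq0 -lt0n.
pose l (j : nat) P : 'M[R]_(k, d) :=
  (1 - j%:R / N%:R) *: c P + (j%:R / N%:R) *: alpha.
have lE j P : c P = alpha -> l j P = alpha.
  by move=> cP; rewrite /l cP -scalerDl subrK scale1r.
suff : forall j, (j <= N)%N -> exists r' : TA -> TA,
    [/\ deformation R idfun r', forall P, through (r' P) (l j P) &
        forall P, through P alpha -> r' P = P].
  move=> /(_ N (leqnn N))[r' [? r'l ?]]; exists r'; split=> // P.
  by have := r'l P; rewrite /l divff// subrr scale0r add0r scale1r.
elim=> [_|j IHj jN].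
  exists r; split=> // P; last by move=> /rcalpha[].
  by rewrite /l mul0r scale0r addr0 subr0 scale1r; exact: rc.
have [r' [r'def r'l r'alpha]] := IHj (ltnW jN).
have l_cont i : continuous (l i).
  move=> P; apply: (cvgD (FF := nbhs_filter P)); last exact: cvg_cst.
  by apply: (cvgZ (FF := nbhs_filter P)); [exact: cvg_cst|exact: c_cont].
have Al i : (i <= N)%N -> forall P, choices A (l i P).
  move=> iN P; apply: choices_conv => //.
  by rewrite divr_ge0//= ler_pdivrMr ?ltr0n// mul1r ler_nat.
have ll P : sqnorm (l j.+1 P - l j P) < delta.
  have -> : l j.+1 P - l j P = (- N%:R^-1) *: (c P - alpha).
    by apply/matrixP => x y; rewrite !mxE -natr1; field.
  rewrite sqnormZ sqrrN exprVn mulrC.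
  by apply: le_lt_trans NC; rewrite ler_wpM2r ?AC// invr_ge0 exprn_ge0.
have [r'' [r''def r''l r''fix]] := deformation_step near_free
  (deformation_continuous r'def) (l_cont j) (l_cont j.+1) (Al _ (ltnW jN)) (Al _ jN)
  ll r'l.
exists r''; split=> // [|P Palpha]; first exact: deformation_trans r'def r''def.
have [_ cP] := rcalpha P Palpha.
by rewrite r''fix ?r'alpha// !lE.
Qed.

End Retraction.

(** * Subspaces containing a given subspace *)

Section LinearAlgebra.
Variable R : realType.

Lemma sub_col_mx p q N (X : 'M[R]_(p, N)) (Y : 'M[R]_(q, N)) :
  (X <= col_mx X Y)%MS /\ (Y <= col_mx X Y)%MS.
Proof. by apply/andP; rewrite -col_mx_sub. Qed.

(** In the factorization of [X] through [col_ebase] and [row_ebase], the first [\rank X] rows of the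
    invertible [row_ebase] span the rows of [X]; its first [n] rows are an extension. *)
Lemma row_free_extension k n N (X : 'M[R]_(k, N)) :
  (\rank X <= n)%N -> (n <= N)%N ->
  exists2 Y : 'M[R]_(n, N), row_free Y & (X <= Y)%MS.
Proof.
move=> Xn nN; exists (pid_mx n *m row_ebase X).
  by rewrite /row_free mxrankMfree ?row_free_unit ?row_ebase_unit// rank_pid_mx.
rewrite -{1}(mulmx_ebase X) submxMr//.
apply/submxP; exists (col_ebase X *m pid_mx (\rank X)).
by rewrite -mulmxA mul_pid_mx; congr (_ *m pid_mx _); lia.
Qed.

(** [beta] is the quotient map by the row space of [X], and [B] is a linear section of it; [lambda]
    and [beta] give coordinates in the basis formed by [X] and [B]. *)
Lemma complement_frame k n N (X : 'M[R]_(k, N)) :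
  row_free X -> N = (k + n)%N ->
  exists (B : 'M[R]_(n, N)) (beta : 'M[R]_(N, n)) (lambda : 'M[R]_(N, k)),
  [/\ B *m beta = 1%:M, X *m beta = 0 & lambda *m X + beta *m B = 1%:M].
Proof.
move=> fX Nkn.
have [B fB BX] : exists2 B : 'M[R]_(n, N), row_free B & (B :=: X^C)%MS.
  have <- : \rank X^C%MS = n by rewrite mxrank_compl (eqP fX); lia.
  by exists (row_base X^C%MS); [exact: row_base_free|exact: eq_row_base].
have /sub_addsmxP[[/= lambda beta] XB1] : (1%:M <= X + B)%MS.
  by rewrite (adds_eqmx (eqmx_refl X) BX) sub1mx addsmx_compl_full.
have XB0 p (Z : 'M[R]_(p, N)) : (Z <= X)%MS -> (Z <= B)%MS -> Z = 0.
  move=> ZX ZB; apply/eqP; rewrite -submx0 -(capmx_compl X) sub_capmx ZX.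
  by rewrite -BX.
exists B, beta, lambda; split=> //.
  apply/eqP; rewrite -subr_eq0 -(mulmx_free_eq0 _ fB); apply/eqP/XB0.
    have E : B = B *m lambda *m X + B *m beta *m B.
      by rewrite -!mulmxA -mulmxDr -XB1 mulmx1.
    have -> : (B *m beta - 1%:M) *m B = - (B *m lambda) *m X.
      by rewrite mulmxBl mul1mx {3}E opprD addrCA subrr addr0 mulNmx.
    exact: submxMl.
  exact: submxMl.
apply/eqP; rewrite -(mulmx_free_eq0 _ fB); apply/eqP/XB0; last exact: submxMl.
have -> : X *m beta *m B = (1%:M - X *m lambda) *m X.
  rewrite mulmxBl mul1mx -{2}[X]mulmx1 XB1 mulmxDr !mulmxA.
  by rewrite addrAC subrr add0r.
exact: submxMl.
Qed.

(** Dependent rows of [hom a] have rank at most [rho + 1], hence lie in a subspace of that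
    dimension, which is a [rho]-plane through all the chosen points. *)
Lemma row_free_choice (d rho : nat) (A : 'I_(rho + 2) -> set 'rV[R]_d)
    (a : 'M[R]_(rho + 2, d)) :
  (rho <= d)%N -> choices A a ->
  (~ exists P : affine_plane R d rho, forall i, plane_points P `&` A i !=set0) ->
  row_free (hom a).
Proof.
move=> rho_d Aa notrans; apply: contra_notT notrans => nfree.
have rk : (\rank (hom a) <= rho + 1)%N.
  have := rank_leq_row (hom a); rewrite /row_free in nfree; lia.
have [|Y fY aY] := row_free_extension rk; first by rewrite leq_add2r.
have dY : \dim <<rows Y>>%VS == (rho + 1)%N by rewrite dim_span_rows.
have [||P _] := transversal_of_space (W := Grassmannian dY) _ Aa.
- by rewrite addn2.
- by apply/eqP; rewrite -sub_orthoproj orthoproj_span_eqmx.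
- by exists (set_val P); exact: (set_valP P).
Qed.

End LinearAlgebra.

Section Quotient.
Variables (R : realType) (k n N : nat).
Variables (X : 'M[R]_(k, N)) (B : 'M[R]_(n, N)).
Variables (beta : 'M[R]_(N, n)) (lambda : 'M[R]_(N, k)).
Hypotheses (X_free : row_free X) (B_beta : B *m beta = 1%:M).
Hypotheses (X_beta : X *m beta = 0) (XB1 : lambda *m X + beta *m B = 1%:M).

(** Rank-nullity: the kernel of [beta] is the row space of [X], which [W] contains. *)
Lemma rank_quotient (W : {vspace 'rV[R]_N}) : X *m orthoproj W = X ->
  \rank (orthoproj W *m beta) = (\dim W - k)%N.
Proof.
move=> XW; rewrite -rank_orthoproj -(mxrank_mul_ker (orthoproj W) beta).
suff -> : \rank (orthoproj W :&: kermx beta) = k by rewrite addnK.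
rewrite -(eqP X_free); apply/eqmx_rank/andP; split; last first.
  rewrite sub_capmx sub_orthoproj XW eqxx/=; apply/sub_kermxP.
  exact: X_beta.
set Z := (_ :&: _)%MS.
have Zbeta : Z *m beta = 0 by apply/sub_kermxP; exact: capmxSr.
rewrite -[Z]mulmx1 -XB1 mulmxDr [Z *m (beta *m _)]mulmxA Zbeta mul0mx addr0.
by rewrite mulmxA submxMl.
Qed.

Lemma B_free : row_free B.
Proof. by apply/row_freeP; exists beta. Qed.

(** The sum is direct because [beta] kills [X] and is injective on the row space of [B]. *)
Lemma rank_lift (V : {vspace 'rV[R]_n}) :
  \rank (col_mx X (orthoproj V *m B)) = (k + \dim V)%N.
Proof.
rewrite -addsmxE mxrank_disjoint_sum.
  by rewrite (eqP X_free) mxrankMfree ?B_free// rank_orthoproj.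
set Z := (_ :&: _)%MS.
have /submxP[u Zu] : (Z <= X)%MS by exact: capmxSl.
have /submxP[w Zw] : (Z <= orthoproj V *m B)%MS by exact: capmxSr.
have : Z *m beta = 0 by rewrite Zu -mulmxA X_beta mulmx0.
rewrite {1}Zw -mulmxA -[orthoproj V *m B *m beta]mulmxA B_beta mulmx1 => wV.
by rewrite Zw mulmxA wV mul0mx.
Qed.

Lemma quotient_lift (V : {vspace 'rV[R]_n}) :
  <<rows (orthoproj <<rows (col_mx X (orthoproj V *m B))>>%VS *m beta)>>%VS = V.
Proof.
rewrite -[RHS]span_orthoproj; apply: eq_span_rows.
apply: (eqmx_trans (eqmxMr beta (orthoproj_span_eqmx _))).
rewrite mul_col_mx X_beta -mulmxA B_beta mulmx1.
apply/eqmxP; rewrite col_mx_sub sub0mx submx_refl/=.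
exact: (sub_col_mx _ _).2.
Qed.

(** The lift lies in [W] because [beta *m B] differs from the identity only by combinations of rows
    of [X], all in [W]; dimensions give equality. *)
Lemma lift_quotient (W : {vspace 'rV[R]_N}) : X *m orthoproj W = X ->
  <<rows (col_mx X (orthoproj <<rows (orthoproj W *m beta)>>%VS *m B))>>%VS = W.
Proof.
move=> XW; have XW' : (X <= orthoproj W)%MS by rewrite sub_orthoproj XW.
apply/eqP; rewrite eqEdim; apply/andP; split; last first.
  rewrite dim_span_rows rank_lift dim_span_rows rank_quotient//.
  by rewrite -leq_subLR.
apply/subvP => v; rewrite mem_span_rows -{2}[W]span_orthoproj mem_span_rows.
move=> /submx_trans; apply; rewrite col_mx_sub XW'/=.
rewrite (eqmxMr B (orthoproj_span_eqmx _)) -mulmxA.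
have -> : beta *m B = 1%:M - lambda *m X by rewrite -XB1 addrAC subrr add0r.
rewrite mulmxBr mulmx1 addmx_sub// eqmx_opp mulmxA.
by apply: submx_trans XW'; exact: submxMl.
Qed.

End Quotient.

(** * Homotopy equivalences obtained from the retraction *)

Lemma homotopic_idfun (R : realType) (X : topologicalType) (f : X -> X) :
  f =1 idfun -> homotopic R f idfun.
Proof.
move=> fid; exists fst; split=> [|x|x] //=.
by apply: continuous_subspaceT => z; exact: cvg_fst.
Qed.

Theorem theorem2 (R : realType) (d m rho : nat)
    (A : 'I_(rho + 2) -> set 'rV[R]_d) (alpha : 'I_(rho + 2) -> 'rV[R]_d)
    (rho_lt_m : (rho < m)%N) (m_le_d1 : (m <= d - 1)%N)
    (A_compact : forall i, compact (A i))
    (A_convex : forall i, convex_set (A i))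
    (alphaA : forall i, A i (alpha i))
    (no_rho_transversal : ~ exists P : affine_plane R d rho,
       forall i, plane_points P `&` A i !=set0) :
  [/\ homotopy_equivalence R (subfun (planes_through_sub (m := m) alphaA)),
      same_homotopy_type R (transversals m A)
        (grassmannian R (d - rho - 1) (m - rho - 1))
    & m = (rho + 1)%N -> contractible R (transversals m A)].
Proof.
pose a : 'M[R]_(rho + 2, d) := \matrix_i alpha i.
have Aa : choices A a by move=> i; rewrite rowK.
have k_gt0 : (0 < rho + 2)%N by rewrite addn2.
have choices_free (b : 'M[R]_(rho + 2, d)) : choices A b -> row_free (hom b).
  by move=> Ab; apply: (row_free_choice _ Ab) => //; lia.
have cA := compact_choices A_compact.
have [r [rdef ra rfix]] :=
  deformation_retraction m k_gt0 cA choices_free A_convex Aa.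
have r_cont := deformation_continuous rdef.
have throughP (P : transversals m A) :
    through P a <-> planes_through m alpha (set_val P).
  rewrite /through -plane_points_hom /planes_through /=.
  by split=> + i => /(_ i); rewrite rowK.
(* The quotient by the [rho + 2] independent lifted points has dimension
   [d + 1 - (rho + 2) = d - rho - 1]. *)
have [B [beta [lambda [Bbeta abeta aB1]]]] :=
  complement_frame (n := (d - rho - 1)%N) (choices_free _ Aa) (ltac:(lia)).
have hom_free := choices_free _ Aa.
have dim_f (P : transversals m A) :
    \dim <<rows (orthoproj (space_of (r P)) *m beta)>>%VS == (m - rho - 1)%N.
  rewrite dim_span_rows (rank_quotient hom_free abeta aB1 (ra P)).
  by rewrite dim_grassmannian; apply/eqP; lia.
(* [f] retracts [P] to a plane through the points, then takes its image in the quotient; [g] below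
   takes the preimage of a subspace of the quotient. *)
pose f P := Grassmannian (dim_f P).
have f_cont : continuous f.
  move=> P; have srP : space_of (r Q) @[Q --> P] --> space_of (r P).
    exact: (continuous_cvg _ (@space_of_continuous _ _ _ _ _ (r P)) (r_cont P)).
  have rP : orthoproj (space_of (r Q)) @[Q --> P] --> orthoproj (space_of (r P)).
    exact: (continuous_cvg _ (@orthoproj_continuous _ _ _ (space_of (r P))) srP).
  apply: (cvg_grassmannian (cvg_mulmx rP (cvg_cst beta))) => //.
  exact: nearW.
have dim_g (V : grassmannian R (d - rho - 1) (m - rho - 1)) :
    \dim <<rows (col_mx (hom a) (orthoproj V *m B))>>%VS == (m + 1)%N.
  rewrite dim_span_rows (rank_lift hom_free Bbeta abeta) dim_grassmannian.
  by apply/eqP; lia.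
have /choice[g gE] : forall V, exists P : transversals m A,
    space_of P = Grassmannian (dim_g V).
  move=> V; apply: (transversal_of_space k_gt0 Aa).
  apply/eqP; rewrite -sub_orthoproj orthoproj_span_eqmx.
  exact: (sub_col_mx _ _).1.
have g_cont : continuous g.
  move=> V; apply: (cvg_transversals (FF := nbhs_filter V)); rewrite gE.
  apply: (cvg_grassmannian (FF := nbhs_filter V)
    (Q := fun V => col_mx (hom a) (orthoproj V *m B))
    (Q0 := col_mx (hom a) (orthoproj V *m B))) => //.
    apply: (cvg_col_mx (FF := nbhs_filter V)); first exact: cvg_cst.
    apply: (cvg_mulmx (FF := nbhs_filter V)); last exact: cvg_cst.
    exact: orthoproj_continuous.
  by apply: nearW => V'; rewrite gE.
have ga V : through (g V) a.
  apply/eqP; rewrite -sub_orthoproj gE orthoproj_span_eqmx.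
  exact: (sub_col_mx _ _).1.
have gK : cancel g f.
  move=> V; apply: grassmannian_inj; rewrite /f /= rfix// gE.
  exact: quotient_lift.
have gf P : g (f P) = r P.
  apply/space_of_inj/grassmannian_inj; rewrite gE /f /=.
  exact: (lift_quotient hom_free Bbeta abeta aB1 (ra P)).
split.
(* [r'] is [r] with values in the planes through the points: on these planes it is the identity, and
   followed by the inclusion it is [r], deformable to the identity. *)
- pose r' P : planes_through m alpha := SigSub (mem_set ((throughP _).1 (ra P))).
  split; first by move=> P; apply: (cvg_set_type (FF := nbhs_filter P));
    exact: (@set_val_continuous _ (planes_through m alpha) P).
  exists r'.
    move=> P; apply: (cvg_set_type (FF := nbhs_filter P)).
    exact: (continuous_cvg _ (@set_val_continuous _ _ (r P)) (r_cont P)).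
  split.
    apply: homotopic_idfun => P; apply: val_inj => /=.
    rewrite rfix//; apply/throughP; exact: set_valP P.
  have -> : subfun (planes_through_sub (m := m) alphaA) \o r' = r.
    by apply/funext => P; exact: val_inj.
  exact/deformation_homotopic/deformation_sym.
- exists f; split=> //; exists g => //; split; last exact: homotopic_idfun.
  have -> : g \o f = r by apply/funext.
  exact/deformation_homotopic/deformation_sym.
- move=> mrho; have n0 : (m - rho - 1 = 0)%N by lia.
  have dV0 : \dim (0%VS : {vspace 'rV[R]_(d - rho - 1)}) == (m - rho - 1)%N.
    by rewrite dimv0 n0.
  exists (g (Grassmannian dV0)).
  (* The Grassmannian of 0-dimensional subspaces is a single point, so [r], which factors through
     it, is constant. *)
  have <- : r = (fun=> g (Grassmannian dV0)).
    apply/funext => P; rewrite -gf; congr g; apply: grassmannian_inj => /=.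
    by apply/eqP; rewrite -dimv_eq0 -[\dim _]/(\dim (f P)) dim_grassmannian n0.
  exact: deformation_homotopic.
Qed.
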